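(* Let $T_{rc}$ be a smooth $(3\times 4)$-transportation polytope. Then the toric ideal $I_{T_{rc}}$ is generated in degree two, i.e. it has a generating set consisting of polynomials of degree at most $2$.
   Context: $\mathbb{N}=\{0,1,2,\dots\}$, $k$ is a field. Transportation polytope: for $r\in\mathbb{N}^m$, $c\in\mathbb{N}^n$, $$T_{rc}=\Big\{A\in\mathbb{R}_{\ge0}^{m\times n}\ \Big|\ \sum_{i=1}^m a_{ij}=c_j\ \forall j,\ \sum_{j=1}^n a_{ij}=r_i\ \forall i\Big\}.$$ It is a lattice polytope. Smoothness: for a polytope $P\subseteq\mathbb{R}^N$ and a vertex $v$, the normal cone is $\mathcal{N}_v(P)=\{\varphi\in(\mathbb{R}^N)^*\mid \varphi(v)=\min_{x\in P}\varphi(x)\}$. Two rational polyhedral cones $\sigma\subseteq\mathbb{R}^N$, $\sigma'\subseteq\mathbb{R}^{N'}$ are lattice equivalent if there is a linear map $\mathbb{R}^N\to\mathbb{R}^{N'}$ mapping $\sigma$ bijectively onto $\sigma'$ and restricting to a lattice isomorphism $\mathbb{Z}^N\cap\operatorname{lin}(\sigma)\to\mathbb{Z}^{N'}\cap\operatorname{lin}(\sigma')$. A $d$-dimensional cone is unimodular if it is lattice equivalent to $\mathbb{R}_{\ge0}^q\times\mathbb{R}^{d-q}$ for some $0\le q\le d$. $P$ is smooth if the normal cone (with respect to the dual lattice $(\mathbb{Z}^N)^*$) at every vertex is unimodular. Toric ideal: for a lattice polytope $P\subseteq\mathbb{R}^N$ put $\mathcal{A}=P\cap\mathbb{Z}^N$.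 The toric ideal $I_P$ is the kernel of the $k$-algebra homomorphism $k[x_a : a\in\mathcal{A}]\to k[t_1^{\pm1},\dots,t_N^{\pm1}]$, $x_a\mapsto t^a$. All variables have degree $1$. *)

(* Defs.v *)
From HB Require Import structures.
From mathcomp Require Import all_boot all_order all_algebra.
From mathcomp Require Import fraction.
From mathcomp Require Import finmap.
From mathcomp Require Import boolp classical_sets functions reals.
From mathcomp Require mpoly.
From mathcomp Require Import monalg.
Import (canonicals, coercions) mpoly.

Set Implicit Arguments.
Unset Strict Implicit.
Unset Printing Implicit Defensive.

Import Order.TTheory GRing.Theory Num.Theory.
Local Open Scope classical_set_scope.
Local Open Scope ring_scope.

Section Polyhedra.
Variable R : realType.

Definition lattice (N : nat) : set 'rV[R]_N :=
  [set map_mx intr a | a in [set: 'rV[int]_N]].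

(* Linear span, as the intersection of all linear subspaces containing X. *)
Definition lin (N : nat) (X : set 'rV[R]_N) : set 'rV[R]_N :=
  [set x | forall U : {vspace 'rV[R]_N}, X `<=` [set` U] -> x \in U].

(* Linear forms on R^N are given by their coordinates in the dual of the
   standard basis, so that the dual lattice (Z^N)^* is again [lattice N]. *)
Definition pairing (N : nat) (phi x : 'rV[R]_N) : R :=
  \sum_(i < N) phi 0 i * x 0 i.

(* Zero-dimensional faces: a linear form attains its minimum over P exactly
   at v. *)
Definition vertex (N : nat) (P : set 'rV[R]_N) (v : 'rV[R]_N) : Prop :=
  P v /\ exists phi : 'rV[R]_N,
    forall x, P x -> x != v -> pairing phi v < pairing phi x.

Definition normal_cone (N : nat) (P : set 'rV[R]_N) (v : 'rV[R]_N) :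
    set 'rV[R]_N :=
  [set phi | P v /\ forall x, P x -> pairing phi v <= pairing phi x].

(* The second bijection is automatically an isomorphism of lattices, being
   the restriction of a linear map. *)
Definition lattice_equivalent (N N' : nat)
    (s : set 'rV[R]_N) (s' : set 'rV[R]_N') : Prop :=
  exists f : {linear 'rV[R]_N -> 'rV[R]_N'},
    set_bij s s' f /\
    set_bij (@lattice N `&` lin s) (@lattice N' `&` lin s') f.

Definition cone_dim (N : nat) (s : set 'rV[R]_N) (d : nat) : Prop :=
  exists2 U : {vspace 'rV[R]_N}, lin s = [set` U] & \dim U = d.

(* R_{>=0}^q x R^(d-q), meant for q <= d *)
Definition half_orthant (d q : nat) : set 'rV[R]_d :=
  [set x | forall i : 'I_d, (i < q)%N -> 0 <= x 0 i].

Definition unimodular (N : nat) (s : set 'rV[R]_N) : Prop :=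
  exists d : nat, cone_dim s d /\
    exists2 q : nat, (q <= d)%N & lattice_equivalent s (@half_orthant d q).

Definition smooth (N : nat) (P : set 'rV[R]_N) : Prop :=
  forall v, vertex P v -> unimodular (normal_cone P v).

Definition lattice_points (N : nat) (P : set 'rV[R]_N) : set 'rV[int]_N :=
  [set a | P (map_mx intr a)].

(* R^(m x n) is identified with R^(m * n) by [mxvec], which lists the entries
   row by row. *)
Definition transportation (m n : nat) (r : 'I_m -> nat) (c : 'I_n -> nat) :
    set 'rV[R]_(m * n) :=
  [set mxvec A | A in [set A : 'M[R]_(m, n) |
    [/\ forall i j, 0 <= A i j,
        forall j, \sum_(i < m) A i j = (c j)%:R
      & forall i, \sum_(j < n) A i j = (r i)%:R]]].

End Polyhedra.

Arguments transportation R {m n} r c.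

(* k[x_a : a in A], the variable x_a being [<< ucm a >>] *)
Notation polyring k A := {malg k[{cmonom A}]}.

Section ToricIdeal.
Variables (k : fieldType) (N : nat).

(* The field k(t_1, ..., t_N), which contains the Laurent polynomial ring
   k[t_1^{+-1}, ..., t_N^{+-1}]; enlarging the codomain in this way does not
   change the kernel defining the toric ideal. *)
Definition ratfun : fieldType := {fraction (mpoly.mpoly N k)}.

Definition ratfunC (x : k) : ratfun := FracField.tofrac (mpoly.mpolyC N x).

Definition ratfunX (i : 'I_N) : ratfun :=
  FracField.tofrac (mpoly.mpolyX k (mpoly.mnm1 i)).

(* t^a *)
Definition laurent_monomial (a : 'rV[int]_N) : ratfun :=
  \prod_(i < N) ratfunX i ^ a 0 i.

(* the image of the monomial prod_a x_a^(u a) *)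
Definition toric_monomial (A : set 'rV[int]_N) (u : {cmonom A}) : ratfun :=
  \prod_(a <- finsupp u) laurent_monomial (val a) ^+ u a.

Definition toric_map (A : set 'rV[int]_N) : polyring k A -> ratfun :=
  mmap ratfunC (@toric_monomial A).

(* [toric_map] is the k-algebra homomorphism with x_a |-> t^a. *)
Fact ratfunC_zmod_morphism : zmod_morphism ratfunC.
Proof. by move=> x y; rewrite /ratfunC !rmorphB. Qed.

Fact ratfunC_monoid_morphism : monoid_morphism ratfunC.
Proof. by split=> [|x y]; rewrite /ratfunC ?rmorphM ?rmorph1. Qed.

HB.instance Definition _ :=
  GRing.isZmodMorphism.Build k ratfun ratfunC ratfunC_zmod_morphism.
HB.instance Definition _ :=
  GRing.isMonoidMorphism.Build k ratfun ratfunC ratfunC_monoid_morphism.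

Fact toric_monomial_mmorphism (A : set 'rV[int]_N) :
  mmorphism (@toric_monomial A).
Proof.
have widen (u : {cmonom A}) (d : {fset A}) : (finsupp u `<=` d)%fset ->
    toric_monomial u = \prod_(a <- d) laurent_monomial (val a) ^+ u a.
  move=> sud; rewrite /toric_monomial (big_fset_incl _ sud) // => a _.
  by rewrite -cmE_eq0 => /eqP ->.
split=> [u v|]; last by rewrite /toric_monomial mdom1 big_seq_fset0.
rewrite !(widen _ (finsupp u `|` finsupp v)%fset) ?mdomD ?fsubsetUl ?fsubsetUr //.
by rewrite -big_split /=; apply: eq_bigr => a _; rewrite cmM exprD.
Qed.

HB.instance Definition _ (A : set 'rV[int]_N) :=
  isMultiplicative.Build {cmonom A} ratfun (@toric_monomial A)
    (toric_monomial_mmorphism A).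

HB.instance Definition _ (A : set 'rV[int]_N) :=
  GRing.RMorphism.copy (@toric_map A) (mmap ratfunC (@toric_monomial A)).

Fact toric_mapC (A : set 'rV[int]_N) (x : k) :
  toric_map (x%:MP : polyring k A) = ratfunC x.
Proof. exact: mmapC. Qed.

Fact toric_mapX (A : set 'rV[int]_N) (a : A) :
  toric_map (<< ucm a >> : polyring k A) = laurent_monomial (val a).
Proof.
rewrite /toric_map mmapU /= (ratfunC_monoid_morphism.1) mul1r.
by rewrite /toric_monomial mdomU big_seq_fset1 cmUU.
Qed.

Definition toric_ideal (R : realType) (P : set 'rV[R]_N) :
    set (polyring k (lattice_points P)) :=
  [set p | toric_map p = 0].

End ToricIdeal.

Arguments toric_ideal k {N R} P.

Definition ideal_generated (S : comNzRingType) (G : set S) : set S :=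
  [set p | exists2 s : seq (S * S),
     (forall x, x \in s -> G x.2) & p = \sum_(x <- s) x.1 * x.2].

(* [msize p] is one more than the total degree of p, and 0 for p = 0. *)
Definition generated_in_degree (k : fieldType) (A : choiceType) (d : nat)
    (I : set (polyring k A)) : Prop :=
  exists2 G : set (polyring k A),
    (forall g, G g -> (msize g <= d.+1)%N) & I = ideal_generated G.

(* Main.v *)
(** Smoothness enters only through the following consequence: no row sum [r i3]
    equals [c j1] or [c j1 + c j4] when enough of the other margins are positive.
    Otherwise [T_rc] has a vertex at which row [i3] is supported on
    [J = {j1}] or [{j1, j4}] and the columns in [J] vanish outside row [i3]; on
    [T_rc] the sum of the coordinates of row [i3] outside [J] equals the sum of
    those of the columns of [J] outside row [i3], and this relation among the
    generators of the normal cone violates the Riesz decomposition property,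
    which every cone equivalent to [R_{>=0}^q x R^(d-q)] enjoys.

    The rest is combinatorial. Two families of lattice points with the same sum
    have to be connected by moves that replace two members [A, B] by [A', B'] with
    [A + B = A' + B'].  It suffices to make a given lattice point [B], bounded by
    the sum of the family, a member of the family, and one does this by decreasing
    the excess of some member [A] over [B] along cycles of [B - A], which have
    length 4 or 6 because there are only three rows. The other members have the
    entries that [A] should gain, and the question is whether these can be gathered
    in one member; the assumption on [r] and [c] is what resolves the only
    configuration in which they cannot. *)

Require Import Defs.
From HB Require Import structures.
From mathcomp Require Import all_boot all_order all_algebra.
From mathcomp Require Import fraction finmap.
From mathcomp Require Import boolp classical_sets functions reals.
From mathcomp Require mpoly.
From mathcomp Require Import monalg.
From mathcomp Require Import zify ring lra.
Import (canonicals, coercions) mpoly.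

Set Implicit Arguments.
Unset Strict Implicit.
Unset Printing Implicit Defensive.

Import Order.TTheory GRing.Theory Num.Theory.
Local Open Scope ring_scope.

(** * Rows and columns under arbitrary labels *)

Lemma uniq_full n (s : seq 'I_n) : uniq s -> size s = n -> forall i, i \in s.
Proof.
move=> us ss i; have /card_uniqP cs := us.
have cE : #|s| = #|'I_n| by rewrite cs ss card_ord.
by have /(subset_cardP cE)-> : s \subset 'I_n by apply/fintype.subsetP.
Qed.

Lemma sum_uniq (V : nmodType) n (s : seq 'I_n) (F : 'I_n -> V) :
  uniq s -> size s = n -> \sum_i F i = \sum_(i <- s) F i.
Proof.
move=> us ss; apply: perm_big; apply: uniq_perm => // [|i].
  exact: index_enum_uniq.
by rewrite mem_index_enum uniq_full.
Qed.

Lemma uniq_extend n (s : seq 'I_n) :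
  uniq s -> (size s < n)%N -> exists i, uniq (i :: s).
Proof.
move=> us ss; case: (pickP [predC s]) => [i /= si|s0]; first by exists i; rewrite /= si.
have /card_uniqP cs := us.
suff : (#|'I_n| <= #|s|)%N by rewrite cs card_ord leqNgt ss.
by apply/subset_leq_card/fintype.subsetP => i _; have /negbFE := s0 i.
Qed.

(** Naming the rows and columns by a duplicate-free list leaves the labelling free, so that
    symmetric cases are instances of one statement. *)
Lemma sum3 (V : nmodType) i1 i2 i3 (F : 'I_3 -> V) :
  uniq [:: i1; i2; i3] -> \sum_i F i = F i1 + F i2 + F i3.
Proof. by move=> u; rewrite (sum_uniq _ u)// !big_cons big_nil addr0 addrA. Qed.

Lemma sum4 (V : nmodType) j1 j2 j3 j4 (F : 'I_4 -> V) :
  uniq [:: j1; j2; j3; j4] -> \sum_j F j = F j1 + F j2 + F j3 + F j4.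
Proof. by move=> u; rewrite (sum_uniq _ u)// !big_cons big_nil addr0 !addrA. Qed.

(** * Exchanges along cycles *)

Section Exchange.
Variables (m n : nat).
Implicit Types A B X : 'M[int]_(m, n).

(** The signed incidence vector of a 4-cycle in the bipartite graph on rows and columns; [exchange6]
    is the one of a hexagon. *)
Definition exchange4 (i1 i2 : 'I_m) (j1 j2 : 'I_n) : 'M[int]_(m, n) :=
  delta_mx i1 j1 + delta_mx i2 j2 - delta_mx i1 j2 - delta_mx i2 j1.

Definition exchange6 (i1 i2 i3 : 'I_m) (j1 j2 j3 : 'I_n) : 'M[int]_(m, n) :=
  delta_mx i1 j1 + delta_mx i2 j2 + delta_mx i3 j3
  - delta_mx i1 j2 - delta_mx i2 j3 - delta_mx i3 j1.

Definition zero_margins X :=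
  (forall i, \sum_j X i j = 0) /\ (forall j, \sum_i X i j = 0).

Let sum_pred1l (b : bool) i1 : \sum_i ((i == i1 :> 'I_m) && b)%:R = b%:R :> int.
Proof. by rewrite (bigD1 i1)//= eqxx big1 ?addr0// => i /negPf->. Qed.

Let sum_pred1r (b : bool) j1 : \sum_j (b && (j == j1 :> 'I_n))%:R = b%:R :> int.
Proof. by rewrite (bigD1 j1)//= eqxx andbT big1 ?addr0// => j /negPf->; rewrite andbF. Qed.

Lemma zero_margins_exchange4 i1 i2 j1 j2 : zero_margins (exchange4 i1 i2 j1 j2).
Proof.
split=> u; under eq_bigr do rewrite !mxE; rewrite !big_split/= !sumrN.
  by rewrite !sum_pred1r; ring.
by rewrite !sum_pred1l; ring.
Qed.

Lemma zero_margins_exchange6 i1 i2 i3 j1 j2 j3 :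
  zero_margins (exchange6 i1 i2 i3 j1 j2 j3).
Proof.
split=> u; under eq_bigr do rewrite !mxE; rewrite !big_split/= !sumrN.
  by rewrite !sum_pred1r; ring.
by rewrite !sum_pred1l; ring.
Qed.
End Exchange.

(** * Lattice points and quadratic moves *)

Section Fibers.
Variables (m n : nat) (r : 'I_m -> nat) (c : 'I_n -> nat).
Implicit Types (A B X : 'M[int]_(m, n)) (s t : seq 'M[int]_(m, n)).

Definition in_fiber A :=
  [/\ forall i j, 0 <= A i j, forall i, \sum_j A i j = (r i)%:Z
    & forall j, \sum_i A i j = (c j)%:Z].

Lemma in_fiberD A X :
  in_fiber A -> zero_margins X -> (forall i j, 0 <= (A + X) i j) -> in_fiber (A + X).
Proof.
move=> [_ rA cA] [rX cX] p; split=> // u; under eq_bigr do rewrite mxE; rewrite big_split/=.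
  by rewrite rA rX addr0.
by rewrite cA cX addr0.
Qed.

Lemma zero_margins_fiberB A B : in_fiber A -> in_fiber B -> zero_margins (B - A).
Proof.
move=> [_ rA cA] [_ rB cB]; split=> u; under eq_bigr do rewrite !mxE; rewrite big_split/= sumrN.
  by rewrite rA rB subrr.
by rewrite cA cB subrr.
Qed.

Lemma in_fiber_exchange4 A i1 i2 j1 j2 : i1 != i2 -> j1 != j2 ->
  in_fiber A -> 1 <= A i1 j2 -> 1 <= A i2 j1 -> in_fiber (A + exchange4 i1 i2 j1 j2).
Proof.
move=> i12 j12 fA a12 a21.
apply: in_fiberD => //; first exact: zero_margins_exchange4.
case: fA => pA _ _ i j; rewrite !mxE; have := pA i j.
have : (i == i1) && (j == j2) -> 1 <= A i j by case/andP=> /eqP-> /eqP->.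
have : (i == i2) && (j == j1) -> 1 <= A i j by case/andP=> /eqP-> /eqP->.
have : ~~ ((i == i1) && (i == i2)) by apply: contra i12 => /andP[/eqP<- /eqP<-].
have : ~~ ((j == j1) && (j == j2)) by apply: contra j12 => /andP[/eqP<- /eqP<-].
by move: (i == i1) (i == i2) (j == j1) (j == j2) => [] [] [] [] //=; lia.
Qed.

Lemma in_fiber_exchange6 A i1 i2 i3 j1 j2 j3 :
  uniq [:: i1; i2; i3] -> uniq [:: j1; j2; j3] ->
  in_fiber A -> 1 <= A i1 j2 -> 1 <= A i2 j3 -> 1 <= A i3 j1 ->
  in_fiber (A + exchange6 i1 i2 i3 j1 j2 j3).
Proof.
rewrite /= !inE !andbT !negb_or => /andP[/andP[i12 i13] i23] /andP[/andP[j12 j13] j23].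
move=> fA a12 a23 a31.
apply: in_fiberD => //; first exact: zero_margins_exchange6.
case: fA => pA _ _ i j; rewrite !mxE; have := pA i j.
have : (i == i1) && (j == j2) -> 1 <= A i j by case/andP=> /eqP-> /eqP->.
have : (i == i2) && (j == j3) -> 1 <= A i j by case/andP=> /eqP-> /eqP->.
have : (i == i3) && (j == j1) -> 1 <= A i j by case/andP=> /eqP-> /eqP->.
have : ~~ ((i == i1) && (i == i2)) by apply: contra i12 => /andP[/eqP<- /eqP<-].
have : ~~ ((i == i1) && (i == i3)) by apply: contra i13 => /andP[/eqP<- /eqP<-].
have : ~~ ((i == i2) && (i == i3)) by apply: contra i23 => /andP[/eqP<- /eqP<-].
have : ~~ ((j == j1) && (j == j2)) by apply: contra j12 => /andP[/eqP<- /eqP<-].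
have : ~~ ((j == j1) && (j == j3)) by apply: contra j13 => /andP[/eqP<- /eqP<-].
have : ~~ ((j == j2) && (j == j3)) by apply: contra j23 => /andP[/eqP<- /eqP<-].
by move: (i == i1) (i == i2) (i == i3) (j == j1) (j == j2) (j == j3) =>
  [] [] [] [] [] [] //=; lia.
Qed.

(** A list stands for the monomial in the variables of its members, and a move for a multiple of a
    quadratic binomial. Permutations express commutativity and bring any two members to the
    front. *)
Inductive quadratically_connected : seq 'M[int]_(m, n) -> seq 'M[int]_(m, n) -> Prop :=
| qconn_perm s t of perm_eq s t : quadratically_connected s t
| qconn_move A B A' B' s of in_fiber A & in_fiber B & in_fiber A' & in_fiber B'
    & A + B = A' + B' : quadratically_connected [:: A, B & s] [:: A', B' & s]
| qconn_trans s t u of quadratically_connected s t & quadratically_connected t u :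
    quadratically_connected s u.

Local Notation qconn := quadratically_connected.

Lemma qconn_catr u s t : qconn s t -> qconn (s ++ u) (t ++ u).
Proof.
elim=> {s t} [s t st|A B A' B' s fA fB fA' fB' e|s t v _ st _ tv].
- by apply: qconn_perm; rewrite perm_cat2r.
- exact: qconn_move.
- exact: qconn_trans st tv.
Qed.

Lemma qconn_cons A s t : qconn s t -> qconn (A :: s) (A :: t).
Proof.
move=> st; have := qconn_catr [:: A] st.
move=> h; apply: qconn_trans (qconn_trans h _); apply: qconn_perm.
  by rewrite perm_sym cats1 perm_rcons.
by rewrite cats1 perm_rcons.
Qed.

Lemma qconn_inv s t : qconn s t -> (forall A, A \in s -> in_fiber A) ->
  [/\ forall A, A \in t -> in_fiber A, size t = size s & \sum_(A <- t) A = \sum_(A <- s) A].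
Proof.
elim=> {s t} [s t st|A B A' B' s fA fB fA' fB' e|s t v _ st _ tv] fs.
- split; [|by rewrite (perm_size st)|by rewrite (perm_big _ st)].
  by move=> A; rewrite -(perm_mem st); apply: fs.
- split=> //; last by rewrite !big_cons !addrA e.
  move=> D; rewrite !inE => /orP[/eqP->//|/orP[/eqP->//|Ds]].
  by apply: fs; rewrite !inE Ds !orbT.
- have [ft st1 st2] := st fs; have [fv tv1 tv2] := tv ft.
  by split=> //; rewrite ?tv1 ?tv2.
Qed.
End Fibers.

(** * Cycles in matrices with zero margins *)

Lemma sum0_pos (I : finType) (F : I -> int) i :
  \sum_i F i = 0 -> F i < 0 -> exists i', 0 < F i'.
Proof.
move=> F0 Fi; case: (pickP (fun i' => 0 < F i')) => [i' p|np]; first by exists i'.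
have : \sum_i F i < 0; last by rewrite F0 ltxx.
rewrite (bigD1 i)//=; apply: ltr_wnDr => //.
by apply: sumr_le0 => j _; have /negbT := np j; rewrite -leNgt.
Qed.

Lemma sum0_neg (I : finType) (F : I -> int) i :
  \sum_i F i = 0 -> 0 < F i -> exists i', F i' < 0.
Proof.
move=> F0 Fi; have NF0 : \sum_i - F i = 0 by rewrite sumrN F0 oppr0.
have NFi : - F i < 0 by rewrite oppr_lt0.
by have [i'] := sum0_pos NF0 NFi; exists i'; rewrite -oppr_gt0.
Qed.

(* The cycle of length 6 has the signs of [exchange6 i i2 i3 j j2 j3]. *)
Lemma conformal_cycle n (D : 'M[int]_(3, n)) i j : zero_margins D -> 0 < D i j ->
  (exists i' j', [/\ D i j' < 0, D i' j < 0 & 0 < D i' j']) \/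
  (exists i2 i3 j2 j3, [/\ uniq [:: i; i2; i3], uniq [:: j; j2; j3],
    [/\ D i j2 < 0, D i2 j3 < 0 & D i3 j < 0] & 0 < D i2 j2 /\ 0 < D i3 j3]).
Proof.
move=> [rD cD] Dij.
case: (pickP (fun p => [&& D i p.2 < 0, D p.1 j < 0 & 0 < D p.1 p.2])).
  by move=> [i' j'] /and3P[? ? ?]; left; exists i', j'.
move=> N; right.
have [j2 d12] := sum0_neg (rD i) Dij; have [i3 d31] := sum0_neg (cD j) Dij.
have d32 : D i3 j2 <= 0 by have := N (i3, j2); rewrite /= d12 d31; lia.
have [i2 d22] := sum0_pos (cD j2) d12; have [j3 d33] := sum0_pos (rD i3) d31.
have d13 : 0 <= D i j3 by have := N (i3, j3); rewrite /= d33 d31; lia.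
have ui : uniq [:: i; i2; i3].
  by rewrite /= !inE !andbT; apply/andP; split; [apply/norP; split|];
    apply/eqP => e; subst; lia.
have uj : uniq [:: j; j2; j3].
  by rewrite /= !inE !andbT; apply/andP; split; [apply/norP; split|];
    apply/eqP => e; subst; lia.
exists i2, i3, j2, j3; split => //; split=> //.
by have := cD j3; rewrite (sum3 _ ui); lia.
Qed.

Lemma uniq3P (T : eqType) (x y z : T) : uniq [:: x; y; z] ->
  ((x == y) = false) * ((y == x) = false) * ((x == z) = false) *
  ((z == x) = false) * ((y == z) = false) * ((z == y) = false).
Proof.
rewrite /= !inE !andbT !negb_or => /andP[/andP[/negPf xy /negPf xz] /negPf yz].
by do !split => //; rewrite eq_sym.
Qed.

Lemma uniq4P (T : eqType) (x y z w : T) : uniq [:: x; y; z; w] ->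
  ((x == y) = false) * ((y == x) = false) * ((x == z) = false) *
  ((z == x) = false) * ((y == z) = false) * ((z == y) = false) *
  ((x == w) = false) * ((w == x) = false) * ((y == w) = false) *
  ((w == y) = false) * ((z == w) = false) * ((w == z) = false).
Proof.
move=> u; have /uniq3P uz : uniq [:: y; z; w] by case/andP: u.
have : x \notin [:: y; z; w] by case/andP: u.
rewrite !inE !negb_or => /and3P[/negPf xy /negPf xz /negPf xw].
by do !split; rewrite ?uz // eq_sym.
Qed.

(** The excluded equations are those under which row [i3] can be filled exactly by the column [j1],
    or by [j1] and [j4] together. The margin [c j4] may vanish. *)
Definition generic_margins (r : 'I_3 -> nat) (c : 'I_4 -> nat) :=
  forall i1 i2 i3 j1 j2 j3 j4, uniq [:: i1; i2; i3] -> uniq [:: j1; j2; j3; j4] ->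
  (0 < r i1)%N -> (0 < r i2)%N -> (0 < r i3)%N ->
  (0 < c j1)%N -> (0 < c j2)%N -> (0 < c j3)%N ->
  r i3 <> c j1 /\ r i3 <> (c j1 + c j4)%N.

(** * Exchanges within a triple of lattice points *)

Section Triples.
Variables (m n : nat) (r : 'I_m -> nat) (c : 'I_n -> nat).
Implicit Types (A B X K L : 'M[int]_(m, n)).
Local Notation qconn := (quadratically_connected r c).
Local Notation fib := (in_fiber r c).

(* What becomes of the two auxiliary members [K] and [L] is irrelevant. *)
Definition reaches A K L B := exists K' L', qconn [:: A; K; L] [:: B; K'; L'].

Lemma qconn_swap A B X s : fib A -> fib B -> fib (A + X) -> fib (B - X) ->
  qconn [:: A, B & s] [:: A + X, B - X & s].
Proof. by move=> *; apply: qconn_move => //; rewrite addrACA subrr addr0. Qed.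

Lemma reaches_refl A K L : reaches A K L A.
Proof. by exists K, L; apply: qconn_perm. Qed.

Lemma reaches12 A K L X B : fib A -> fib K -> fib (A + X) -> fib (K - X) ->
  reaches (A + X) (K - X) L B -> reaches A K L B.
Proof.
move=> fA fK fAX fKX [K' [L' e]]; exists K', L'; apply: qconn_trans e.
exact: qconn_swap.
Qed.

Lemma reaches_sym A K L B : reaches A K L B -> reaches A L K B.
Proof.
move=> [K' [L' e]]; exists K', L'; apply: qconn_trans e.
by apply: qconn_perm; rewrite (perm_cons A) (perm_catC [:: L] [:: K]).
Qed.

Lemma reaches13 A K L X B : fib A -> fib L -> fib (A + X) -> fib (L - X) ->
  reaches (A + X) K (L - X) B -> reaches A K L B.
Proof. by move=> fA fL fAX fLX /reaches_sym e; apply/reaches_sym/reaches12; eauto. Qed.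

Lemma reaches23 A K L X B : fib K -> fib L -> fib (K + X) -> fib (L - X) ->
  reaches A (K + X) (L - X) B -> reaches A K L B.
Proof.
move=> fK fL fKX fLX [K' [L' e]]; exists K', L'; apply: qconn_trans e.
by apply: qconn_cons; apply: qconn_swap.
Qed.

Lemma exchange4N (i1 i2 : 'I_m) (j1 j2 : 'I_n) :
  - exchange4 i1 i2 j1 j2 = exchange4 i1 i2 j2 j1.
Proof. by apply/matrixP => i j; rewrite !mxE; ring. Qed.

Lemma in_fiberB_exchange4 A i1 i2 j1 j2 : i1 != i2 -> j1 != j2 ->
  fib A -> 1 <= A i1 j1 -> 1 <= A i2 j2 -> fib (A - exchange4 i1 i2 j1 j2).
Proof.
move=> i12 j12 fA a11 a22; rewrite exchange4N.
by apply: in_fiber_exchange4; rewrite // eq_sym.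
Qed.

Lemma exchange6N (i1 i2 i3 : 'I_m) (j1 j2 j3 : 'I_n) :
  - exchange6 i1 i2 i3 j1 j2 j3 = exchange6 i1 i3 i2 j2 j1 j3.
Proof. by apply/matrixP => i j; rewrite !mxE; ring. Qed.

Lemma in_fiberB_exchange6 A i1 i2 i3 j1 j2 j3 :
  uniq [:: i1; i2; i3] -> uniq [:: j1; j2; j3] ->
  fib A -> 1 <= A i1 j1 -> 1 <= A i2 j2 -> 1 <= A i3 j3 ->
  fib (A - exchange6 i1 i2 i3 j1 j2 j3).
Proof.
move=> ui uj fA a11 a22 a33; rewrite exchange6N; apply: in_fiber_exchange6 => //.
  by rewrite /= !inE !(uniq3P ui).
by rewrite /= !inE !(uniq3P uj).
Qed.

Lemma reaches_direct A K L i1 i2 j1 j2 : i1 != i2 -> j1 != j2 ->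
  fib A -> fib K -> 1 <= A i1 j2 -> 1 <= A i2 j1 -> 1 <= K i1 j1 -> 1 <= K i2 j2 ->
  reaches A K L (A + exchange4 i1 i2 j1 j2).
Proof.
move=> i12 j12 fA fK *; apply: (reaches12 (X := exchange4 i1 i2 j1 j2)) => //.
- exact: in_fiber_exchange4.
- exact: in_fiberB_exchange4.
- exact: reaches_refl.
Qed.
End Triples.

(** * The obstructed triple *)

Section Hexagon.
Variables (r : 'I_3 -> nat) (c : 'I_4 -> nat).
Hypothesis nd : generic_margins r c.
Implicit Types A K L : 'M[int]_(3, 4).
Local Notation fib := (in_fiber r c).
Local Notation reaches := (reaches r c).

Lemma fiber_ge0 A : fib A -> forall i j, 0 <= A i j.
Proof. by case. Qed.

Lemma reaches_eq A K L B : A = B -> reaches A K L B.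
Proof. by move->; apply: reaches_refl. Qed.

Lemma fiber_margins A i1 i2 i3 j1 j2 j3 j4 :
  uniq [:: i1; i2; i3] -> uniq [:: j1; j2; j3; j4] -> fib A ->
  (forall i, A i j1 + A i j2 + A i j3 + A i j4 = (r i)%:Z) /\
  (forall j, A i1 j + A i2 j + A i3 j = (c j)%:Z).
Proof.
move=> ui uj [_ rA cA]; split=> u; first by rewrite -rA (sum4 _ uj).
by rewrite -cA (sum3 _ ui).
Qed.

Ltac entry ri cj := rewrite ?mxE ?eqxx ?ri ?cj /=;
  match goal with
  | p : forall i j, is_true (0 <= fun_of_matrix ?M i j) |- context [fun_of_matrix ?M ?i ?j] =>
    move: (p i j); lia
  end.
Ltac fiber ri cj := first [assumption
  | match goal with
    | |- is_true (_ != _) => rewrite ?ri ?cj //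
    | |- in_fiber _ _ (_ + exchange4 _ _ _ _) => apply: in_fiber_exchange4; fiber ri cj
    | |- in_fiber _ _ (_ - exchange4 _ _ _ _) => apply: in_fiberB_exchange4; fiber ri cj
    | |- _ => entry ri cj
    end].
Ltac finish ri cj := first
  [ apply: reaches_direct; fiber ri cj
  | apply/reaches_sym/reaches_direct; fiber ri cj].
Ltac telescope := by apply: reaches_eq; apply/matrixP => i j; rewrite !mxE; ring.

(* [K] has the entry at [(i1, j1)] and [L] the one at [(i2, j2)], but [L - K] is
   supported on a hexagon whose exchange moves the former out of [K] while it moves
   the latter in.  Any further nonzero entry of [A], [K] or [L] in the 3 x 3 minor
   yields a detour of 4-cycles; if there is none, the margins are determined up to
   the common value [u] of [K i3 j4] and [L i3 j4]: [r i3 = c j1 + c j2 - 1 + u]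
   with [u = 0] or [u = c j4]. *)
Lemma exchange_triple_obstructed i1 i2 i3 j1 j2 j3 j4 A K L :
  uniq [:: i1; i2; i3] -> uniq [:: j1; j2; j3; j4] ->
  fib A -> fib K -> fib L -> 1 <= A i1 j2 -> 1 <= A i2 j1 ->
  1 <= K i1 j1 -> 1 <= K i3 j2 -> 1 <= K i2 j3 ->
  1 <= L i2 j2 -> 1 <= L i3 j1 -> 1 <= L i1 j3 ->
  reaches A K L (A + exchange4 i1 i2 j1 j2).
Proof.
move=> ui uj fA fK fL a12 a21 k11 k32 k23 l22 l31 l13.
have ri := uniq3P ui; have cj := uniq4P uj.
have pA := fiber_ge0 fA; have pK := fiber_ge0 fK; have pL := fiber_ge0 fL.
(* An entry of [A] in row [i3] or column [j3] splits the desired exchange into two 4-cycles, one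
   traded with [K] and one with [L]; their auxiliary positions cancel. *)
case: (lerP 1 (A i3 j1)) => a31.
  apply: (reaches12 (X := exchange4 i1 i3 j1 j2)); [fiber ri cj..|].
  apply: (reaches13 (X := exchange4 i2 i3 j2 j1)); [fiber ri cj..|telescope].
case: (lerP 1 (A i3 j2)) => a32.
  apply: (reaches13 (X := exchange4 i2 i3 j2 j1)); [fiber ri cj..|].
  apply: (reaches12 (X := exchange4 i1 i3 j1 j2)); [fiber ri cj..|telescope].
case: (lerP 1 (A i1 j3)) => a13.
  apply: (reaches12 (X := exchange4 i1 i2 j1 j3)); [fiber ri cj..|].
  apply: (reaches13 (X := exchange4 i2 i1 j2 j3)); [fiber ri cj..|telescope].
case: (lerP 1 (A i2 j3)) => a23.
  apply: (reaches13 (X := exchange4 i2 i1 j2 j3)); [fiber ri cj..|].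
  apply: (reaches12 (X := exchange4 i1 i2 j1 j3)); [fiber ri cj..|telescope].
(* From here on, the entries at [(i1, j1)] and [(i2, j2)] are to be brought together in one of [K]
   and [L] by exchanges between these two. *)
case: (lerP 1 (K i2 j2)) => k22; first finish ri cj.
case: (lerP 1 (L i1 j1)) => l11; first finish ri cj.
case: (lerP 1 (L i3 j3)) => l33.
  apply: (reaches23 (X := exchange4 i2 i3 j2 j3)); [fiber ri cj..|finish ri cj].
case: (lerP 1 (K i3 j3)) => k33.
  apply: (reaches23 (X := exchange4 i1 i3 j3 j1)); [fiber ri cj..|finish ri cj].
case: (lerP 1 (K i1 j2)) => k12.
  apply: (reaches23 (X := exchange4 i2 i1 j2 j3)); [fiber ri cj..|finish ri cj].
case: (lerP 1 (K i2 j1)) => k21.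
  apply: (reaches23 (X := exchange4 i2 i3 j2 j1)); [fiber ri cj..|finish ri cj].
case: (lerP 1 (L i1 j2)) => l12.
  apply: (reaches23 (X := exchange4 i1 i3 j2 j1)); [fiber ri cj..|finish ri cj].
case: (lerP 1 (L i2 j1)) => l21.
  apply: (reaches23 (X := exchange4 i1 i2 j3 j1)); [fiber ri cj..|finish ri cj].
have uj' : uniq [:: j2; j3; j1] by rewrite /= !inE !cj.
have ui' : uniq [:: i2; i1; i3] by rewrite /= !inE !ri.
have fKX : fib (K + exchange6 i2 i1 i3 j2 j3 j1) by apply: in_fiber_exchange6.
have fLX : fib (L - exchange6 i2 i1 i3 j2 j3 j1) by apply: in_fiberB_exchange6.
(* The hexagon takes only one unit from [(i1, j1)] in [K], so with two units there [K] ends up with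
   both entries; likewise for [(i2, j2)] in [L]. *)
case: (lerP 2 (K i1 j1)) => k11'.
  apply: (reaches23 (X := exchange6 i2 i1 i3 j2 j3 j1)); [assumption..|].
  by finish ri cj.
case: (lerP 2 (L i2 j2)) => l22'.
  apply: (reaches23 (X := exchange6 i2 i1 i3 j2 j3 j1)); [assumption..|].
  by finish ri cj.
have [rK cK] := fiber_margins ui uj fK; have [rL cL] := fiber_margins ui uj fL.
have [rA cA] := fiber_margins ui uj fA.
have eu : K i3 j4 = L i3 j4.
  move: (rK i3) (rL i3) (cK j1) (cL j1) (cK j2) (cL j2).
  move: (pK i3 j1) (pK i3 j3) (pK i1 j2) (pK i2 j1) (pK i2 j2).
  by move: (pL i3 j3) (pL i1 j2) (pL i2 j1) (pL i1 j1); lia.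
(* If [K i3 j4] is positive, a unit at [(i1, j4)] in [L], or at [(i1, j4)] or [(i2, j4)] in [K],
   allows a detour through column [j4]. Otherwise all of that column of [K] lies in row [i3]. *)
suff escape : K i3 j4 = 0 \/ K i3 j4 = (c j4)%:Z -> reaches A K L (A + exchange4 i1 i2 j1 j2).
  case: (lerP 1 (K i3 j4)) => k34; last by apply: escape; have := pK i3 j4; lia.
  case: (lerP 1 (L i1 j4)) => l14.
    apply: (reaches23 (X := exchange4 i1 i3 j4 j1)); [fiber ri cj..|finish ri cj].
  case: (lerP 1 (K i2 j4)) => k24.
    apply: (reaches23 (X := exchange4 i2 i3 j2 j4)); [fiber ri cj..|finish ri cj].
  case: (lerP 1 (K i1 j4)) => k14.
    have l24 : 1 <= L i2 j4 by move: (cK j4) (cL j4) (pK i2 j4) (pL i1 j4); lia.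
    apply: (reaches23 (X := exchange4 i1 i2 j3 j4)); [fiber ri cj..|].
    apply: (reaches23 (X := exchange4 i2 i3 j2 j4)); [fiber ri cj..|finish ri cj].
  by apply: escape; right; move: (cK j4) (pK i1 j4) (pK i2 j4); lia.
move=> u34.
(* Write [u] for [K i3 j4]. If [K i3 j1 = 0] then [c j1 = 1] and [r i3 = c j2 + u]; if [K i3 j2 = 1]
   then [c j2 = 1] and [r i3 = c j1 + u]. As [u] is 0 or [c j4], [nd] excludes both. *)
have [ge1 ge2] : 1 <= K i3 j1 /\ 2 <= K i3 j2.
  have uj2 : uniq [:: j2; j1; j3; j4] by rewrite /= !inE !cj.
  move: (nd ui uj) (nd ui uj2).
  move: (rA i1) (rA i2) (rK i3) (rL i3) (cK j1) (cK j2) (cK j3) (cL j1) (cL j2).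
  move: (pK i3 j1) (pK i3 j3) (pK i1 j2) (pK i2 j1) (pK i2 j2).
  move: (pL i3 j3) (pL i1 j2) (pL i2 j1) (pL i1 j1).
  move: (pA i1 j1) (pA i1 j3) (pA i1 j4) (pA i2 j2) (pA i2 j3) (pA i2 j4).
  move: (pK i1 j3) (pK i3 j4).
  clear -u34 a12 a21 k11 k32 k23 l22 l31 l13 k22 l11 l33 k33 k12 k21 l12 l21 k11' l22' eu.
  lia.
(* The last detour passes through [K] twice, and needs [K i3 j2 >= 2]. *)
have a33 : 1 <= A i3 j3.
  move: (cA j3) (cK j3) (pA i1 j3) (pA i2 j3) (pK i1 j3) (pK i3 j3); lia.
apply: (reaches12 (X := exchange4 i2 i3 j3 j1)); [fiber ri cj..|].
apply: (reaches12 (X := exchange4 i1 i3 j1 j2)); [fiber ri cj..|].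
apply: (reaches23 (X := exchange4 i2 i3 j2 j1)); [fiber ri cj..|].
apply: (reaches12 (X := exchange4 i2 i3 j2 j3)); [fiber ri cj..|telescope].
Qed.
End Hexagon.

(** * Connectivity of the fibers *)

Section Connectivity.
Variables (r : 'I_3 -> nat) (c : 'I_4 -> nat).
Hypothesis nd : generic_margins r c.
Implicit Types (A B K L : 'M[int]_(3, 4)) (s t : seq 'M[int]_(3, 4)).
Local Notation fib := (in_fiber r c).
Local Notation reaches := (reaches r c).
Local Notation qconn := (quadratically_connected r c).

(** A conformal cycle of [L - K] through [(i2, j2)] moves that entry into [K]. A 4-cycle lowers [K]
    only in row [i2] or column [j2] and so spares [(i1, j1)]; a hexagon lowers [(i1, j1)] only in
    the obstructed configuration. *)
Lemma exchange_triple i1 i2 j1 j2 A K L : i1 != i2 -> j1 != j2 ->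
  fib A -> fib K -> fib L -> 1 <= A i1 j2 -> 1 <= A i2 j1 ->
  1 <= K i1 j1 -> 1 <= L i2 j2 -> reaches A K L (A + exchange4 i1 i2 j1 j2).
Proof.
move=> i12 j12 fA fK fL a12 a21 k11 l22.
have pK := fiber_ge0 fK; have pL := fiber_ge0 fL.
case: (lerP 1 (K i2 j2)) => k22; first exact: reaches_direct.
have LK : 0 < (L - K) i2 j2 by rewrite !mxE /=; lia.
case: (conformal_cycle (zero_margins_fiberB fK fL) LK) => [[i' [j' []]]|].
  rewrite !mxE /= => d1 d2 d3.
  have i2' : i2 != i' by apply/eqP => e; subst; lia.
  have j2' : j2 != j' by apply/eqP => e; subst; lia.
  have [p1 p2 p3] : [/\ 0 <= K i' j', 0 <= L i2 j' & 0 <= L i' j2] by [].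
  have fKX : fib (K + exchange4 i2 i' j2 j').
    by apply: in_fiber_exchange4 => //; lia.
  apply: (reaches23 (X := exchange4 i2 i' j2 j')) => //.
    by apply: in_fiberB_exchange4 => //; lia.
  apply: reaches_direct => //; rewrite !mxE ?eqxx /=.
    by rewrite (negPf i12) (negPf j12) /= andbF; case: (_ && _) => /=; lia.
  by rewrite (negPf i2') (negPf j2') /=; have := pK i2 j2; lia.
move=> [p2 [p3 [q2 [q3 [ui uj [d1 d2 d3] [d4 d5]]]]]].
move: d1 d2 d3 d4 d5; rewrite !mxE /= => d1 d2 d3 d4 d5.
case: (boolP ((p2 == i1) && (q3 == j1))) => [/andP[/eqP ? /eqP ?]|e].
  subst; have ui3 : uniq [:: i1; i2; p3] by rewrite /= !inE !(uniq3P ui).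
  have uj3 : uniq [:: j1; j2; q2] by rewrite /= !inE !(uniq3P uj).
  have [||j4 uj4] := @uniq_extend _ [:: j1; j2; q2] => //.
  have uj' : uniq [:: j1; j2; q2; j4] by rewrite -(rot_uniq 3).
  have [pK12 pK31 pL32] : [/\ 0 <= K i1 q2, 0 <= K p3 q2 & 0 <= L p3 j2] by [].
  have [pL23 pL11 pK31'] : [/\ 0 <= L i2 q2, 0 <= L i1 j1 & 0 <= K p3 j1] by [].
  by apply: (exchange_triple_obstructed nd ui3 uj') => //; lia.
have fKX : fib (K + exchange6 i2 p2 p3 j2 q2 q3).
  have [p4 p5 p6] : [/\ 0 <= L i2 q2, 0 <= L p2 q3 & 0 <= L p3 j2] by [].
  by apply: in_fiber_exchange6 => //; lia.
apply: (reaches23 (X := exchange6 i2 p2 p3 j2 q2 q3)) => //.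
  have [p4 p5] : 0 <= K p2 q2 /\ 0 <= K p3 q3 by [].
  by apply: in_fiberB_exchange6 => //; lia.
apply: reaches_direct => //; rewrite !mxE ?eqxx /=; last first.
  by rewrite !(uniq3P ui) !(uniq3P uj) /=; have := pK i2 j2; lia.
rewrite (negPf i12) (negPf j12) /= andbF [i1 == p2]eq_sym [j1 == q3]eq_sym (negPf e).
by do 2 case: (_ && _) => /=; lia.
Qed.

Lemma entry_sum_gt0 s i j : 1 <= (\sum_(B <- s) B) i j ->
  exists2 K, K \in s & 1 <= K i j.
Proof.
rewrite summxE => s1; case: (boolP (has (fun K : 'M[int]_(3, 4) => 1 <= K i j) s)) => [/hasP//|].
move=> /hasPn n; suff : \sum_(B <- s) B i j <= 0 by move=> /(le_trans s1).
by rewrite big_seq; apply: sumr_le0 => B /n; rewrite -ltNge; lia.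
Qed.

Lemma entry_sum_ge0 s i j : (forall B, B \in s -> fib B) -> 0 <= (\sum_(B <- s) B) i j.
Proof.
by move=> fs; rewrite summxE big_seq; apply: sumr_ge0 => B /fs/fiber_ge0.
Qed.

Lemma entry_sum_ge K s i j : (forall B, B \in s -> fib B) -> K \in s ->
  K i j <= (\sum_(B <- s) B) i j.
Proof.
move=> fs Ks; rewrite (perm_big _ (perm_to_rem Ks)) big_cons mxE lerDl.
by apply: entry_sum_ge0 => B /mem_rem/fs.
Qed.

Lemma exchange_list i1 i2 j1 j2 A s : i1 != i2 -> j1 != j2 ->
  (forall B, B \in A :: s -> fib B) -> 1 <= A i1 j2 -> 1 <= A i2 j1 ->
  1 <= (\sum_(B <- s) B) i1 j1 -> 1 <= (\sum_(B <- s) B) i2 j2 ->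
  exists s', qconn (A :: s) (A + exchange4 i1 i2 j1 j2 :: s').
Proof.
move=> i12 j12 fs a12 a21 /entry_sum_gt0[K Ks k11] /entry_sum_gt0[L Ls l22].
have fA : fib A by apply: fs; rewrite inE eqxx.
have fK : fib K by apply: fs; rewrite inE Ks orbT.
have fL : fib L by apply: fs; rewrite inE Ls orbT.
have pK : qconn (A :: s) [:: A, K & rem K s].
  by apply: qconn_perm; rewrite perm_cons perm_to_rem.
have [e|LK] := eqVneq L K.
  subst; exists (K - exchange4 i1 i2 j1 j2 :: rem K s); apply: qconn_trans pK _.
  apply: qconn_swap => //; first exact: in_fiber_exchange4.
  exact: in_fiberB_exchange4.
have Ls' : L \in rem K s.
  by move: Ls; rewrite (perm_mem (perm_to_rem Ks)) inE (negPf LK).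
have [K' [L' e]] := exchange_triple i12 j12 fA fK fL a12 a21 k11 l22.
exists [:: K', L' & rem L (rem K s)].
apply: qconn_trans pK (qconn_trans _ (qconn_catr (rem L (rem K s)) e)).
by apply: qconn_perm; rewrite !perm_cons perm_to_rem.
Qed.

(** For points of one fiber, whose entries have the same total, this is half the l1-distance. *)
Definition excess (A B : 'M[int]_(3, 4)) : int :=
  \sum_i \sum_j Num.max 0 (A i j - B i j).

Lemma excess_ge0 A B : 0 <= excess A B.
Proof. by do 2 (apply: sumr_ge0 => ? _); rewrite le_max lexx. Qed.

(** Raising an entry where [A] is below [B] costs nothing, and lowering one never costs and pays 1
    where [A] exceeds [B]. The corner [(i2, j1)] may thus be arbitrary. *)
Lemma excess_exchange4 i1 i2 j1 j2 A B : i1 != i2 -> j1 != j2 ->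
  (A i1 j1 < B i1 j1) -> (A i2 j2 < B i2 j2) ->
  (B i1 j2 < A i1 j2) ->
  excess (A + exchange4 i1 i2 j1 j2) B < excess A B.
Proof.
move=> i12 j12.
have ui2 : uniq [:: i1; i2] by rewrite /= inE i12.
have uj2 : uniq [:: j1; j2] by rewrite /= inE j12.
have [i3 ui] := uniq_extend ui2 isT; have [j3 uj3] := uniq_extend uj2 isT.
have [j4 uj] := uniq_extend uj3 isT.
rewrite /excess !(sum3 _ ui) !(sum4 _ uj) !mxE !eqxx !(uniq3P ui) !(uniq4P uj) /=.
rewrite !(addr0, subr0).
move: (Num.max 0 (A i3 j1 - B i3 j1)) (Num.max 0 (A i3 j2 - B i3 j2)) =>  x31 x32.
move: (Num.max 0 (A i3 j3 - B i3 j3)) (Num.max 0 (A i3 j4 - B i3 j4)) => x33 x34.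
move: (Num.max 0 (A i1 j3 - B i1 j3)) (Num.max 0 (A i1 j4 - B i1 j4)) => x13 x14.
move: (Num.max 0 (A i2 j3 - B i2 j3)) (Num.max 0 (A i2 j4 - B i2 j4)) => x23 x24.
lia.
Qed.

(** The two lowered entries pay 2, while raising the arbitrary corner [(i2, j2)] costs at most 1. *)
Lemma excess_exchange4' i1 i2 j1 j2 A B : i1 != i2 -> j1 != j2 ->
  (A i1 j1 < B i1 j1) -> (B i1 j2 < A i1 j2) -> (B i2 j1 < A i2 j1) ->
  excess (A + exchange4 i1 i2 j1 j2) B < excess A B.
Proof.
move=> i12 j12.
have ui2 : uniq [:: i1; i2] by rewrite /= inE i12.
have uj2 : uniq [:: j1; j2] by rewrite /= inE j12.
have [i3 ui] := uniq_extend ui2 isT; have [j3 uj3] := uniq_extend uj2 isT.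
have [j4 uj] := uniq_extend uj3 isT.
rewrite /excess !(sum3 _ ui) !(sum4 _ uj) !mxE !eqxx !(uniq3P ui) !(uniq4P uj) /=.
rewrite !(addr0, subr0).
move: (Num.max 0 (A i3 j1 - B i3 j1)) (Num.max 0 (A i3 j2 - B i3 j2)) =>  x31 x32.
move: (Num.max 0 (A i3 j3 - B i3 j3)) (Num.max 0 (A i3 j4 - B i3 j4)) => x33 x34.
move: (Num.max 0 (A i1 j3 - B i1 j3)) (Num.max 0 (A i1 j4 - B i1 j4)) => x13 x14.
move: (Num.max 0 (A i2 j3 - B i2 j3)) (Num.max 0 (A i2 j4 - B i2 j4)) => x23 x24.
lia.
Qed.

Lemma excess_exchange6 i1 i2 i3 j1 j2 j3 A B :
  uniq [:: i1; i2; i3] -> uniq [:: j1; j2; j3] ->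
  A i1 j1 < B i1 j1 -> A i2 j2 < B i2 j2 -> A i3 j3 < B i3 j3 ->
  B i1 j2 < A i1 j2 -> B i2 j3 < A i2 j3 -> B i3 j1 < A i3 j1 ->
  excess (A + exchange6 i1 i2 i3 j1 j2 j3) B < excess A B.
Proof.
move=> ui uj3; have [j4 uj] := uniq_extend uj3 isT.
rewrite /excess !(sum3 _ ui) !(sum4 _ uj) !mxE !eqxx !(uniq3P ui) !(uniq4P uj) /=.
rewrite !(addr0, subr0).
move: (Num.max 0 (A i1 j3 - B i1 j3)) (Num.max 0 (A i1 j4 - B i1 j4)) => x13 x14.
move: (Num.max 0 (A i2 j1 - B i2 j1)) (Num.max 0 (A i2 j4 - B i2 j4)) => x21 x24.
move: (Num.max 0 (A i3 j2 - B i3 j2)) (Num.max 0 (A i3 j4 - B i3 j4)) => x32 x34.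
lia.
Qed.
End Connectivity.

(** * Absorbing a prescribed lattice point *)

Section Absorption.
Variables (r : 'I_3 -> nat) (c : 'I_4 -> nat).
Hypothesis nd : generic_margins r c.
Implicit Types (A B K L : 'M[int]_(3, 4)) (s t : seq 'M[int]_(3, 4)).
Local Notation fib := (in_fiber r c).
Local Notation qconn := (quadratically_connected r c).

(** [X] is a conformal cycle of [L - K] through [(i1, j1)]. A 4-cycle lowers [K] only in row [i1] or
    column [j1]. A hexagon lowering [(i2, j2)] would raise [(i3, j2)], and one lowering [(i3, j3)]
    would lower [(i2, j1)]; but [L - K] vanishes at [(i3, j2)] and [(i2, j1)]. *)
Lemma gather i1 i2 i3 j1 j2 j3 K L :
  uniq [:: i1; i2; i3] -> uniq [:: j1; j2; j3] -> fib K -> fib L ->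
  [/\ K i1 j3 = 0, K i2 j1 = 0 & K i3 j2 = 0] ->
  [/\ L i1 j3 = 0, L i2 j1 = 0 & L i3 j2 = 0] -> K i1 j1 < L i1 j1 ->
  exists X, [/\ fib (K + X), fib (L - X), 1 <= X i1 j1, 0 <= X i2 j2 & 0 <= X i3 j3].
Proof.
move=> ui uj fK fL [K13 K21 K32] [L13 L21 L32] KL.
have ri := uniq3P ui; have cj := uniq3P uj.
have pK := fiber_ge0 fK; have pL := fiber_ge0 fL.
have LK : 0 < (L - K) i1 j1 by rewrite !mxE subr_gt0.
case: (conformal_cycle (zero_margins_fiberB fK fL) LK) => [[i' [j' []]]|].
  rewrite !mxE /= => d1 d2 d3.
  have i1' : i1 != i' by apply/eqP => e; subst; lia.
  have j1' : j1 != j' by apply/eqP => e; subst; lia.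
  have [p1 p2 p3] : [/\ 0 <= K i' j', 0 <= L i1 j' & 0 <= L i' j1] by [].
  exists (exchange4 i1 i' j1 j'); split.
  - by apply: in_fiber_exchange4 => //; lia.
  - by apply: in_fiberB_exchange4 => //; have := pK i1 j1; lia.
  - by rewrite !mxE !eqxx (negPf i1') (negPf j1').
  - by rewrite !mxE !ri !cj /= andbF; case: (_ && _).
  - by rewrite !mxE !ri !cj /= andbF; case: (_ && _).
move=> [p2 [p3 [q2 [q3 [up uq [d1 d2 d3] [d4 d5]]]]]].
move: d1 d2 d3 d4 d5; rewrite !mxE /= => d1 d2 d3 d4 d5.
have rp := uniq3P up; have cq := uniq3P uq.
have [s1 s2 s3] : [/\ 0 <= L i1 q2, 0 <= L p2 q3 & 0 <= L p3 j1] by [].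
have [s4 s5 s6] : [/\ 0 <= K p2 q2, 0 <= K p3 q3 & 0 <= K i1 j1] by [].
exists (exchange6 i1 p2 p3 j1 q2 q3); split.
- by apply: in_fiber_exchange6 => //; lia.
- by apply: in_fiberB_exchange6 => //; lia.
- by rewrite !mxE !eqxx !rp !cq.
- rewrite !mxE !ri !cj /= !andbF.
  case: (boolP ((i2 == p2) && (j2 == q3))) => [/andP[/eqP ? /eqP ?]|_]; last first.
    by do 2 case: (_ && _).
  subst; have : p3 \in [:: i1; p2; i3] by apply: uniq_full.
  by rewrite !inE !rp => /= /eqP ?; subst; lia.
- rewrite !mxE !ri !cj /= !andbF.
  case: (boolP ((i3 == p2) && (j3 == q3))) => [/andP[/eqP ? /eqP ?]|_]; last first.
    by do 2 case: (_ && _).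
  subst; have : p3 \in [:: i1; i2; p2] by apply: uniq_full.
  by rewrite !inE !rp orbF => /= /eqP ?; subst; lia.
Qed.

Lemma gather_list i1 i2 i3 j1 j2 j3 K s :
  uniq [:: i1; i2; i3] -> uniq [:: j1; j2; j3] ->
  (forall B, B \in K :: s -> fib B) ->
  let S := \sum_(B <- K :: s) B in
  [/\ S i1 j3 = 0, S i2 j1 = 0 & S i3 j2 = 0] -> 1 <= S i1 j1 ->
  exists K' s', [/\ qconn (K :: s) (K' :: s'), 1 <= K' i1 j1,
    K i2 j2 <= K' i2 j2 & K i3 j3 <= K' i3 j3].
Proof.
move=> ui uj fs S [S13 S21 S32] S11.
case: (lerP 1 (K i1 j1)) => K11.
  by exists K, s; split => //; apply: qconn_perm.
have [L Ls L11] : exists2 L, L \in s & 1 <= L i1 j1.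
  have [L] := entry_sum_gt0 S11.
  by rewrite inE => /orP[/eqP->|]; [rewrite leNgt K11|exists L].
have fK : fib K by apply: fs; rewrite inE eqxx.
have fL : fib L by apply: fs; rewrite inE Ls orbT.
have zero0 B i j : B \in K :: s -> S i j = 0 -> B i j = 0.
  move=> Bs S0; apply/eqP; rewrite eq_le -{1}S0 (entry_sum_ge _ _ fs Bs)/=.
  exact/fiber_ge0/fs.
have Ks : K \in K :: s by rewrite inE eqxx.
have Ls' : L \in K :: s by rewrite inE Ls orbT.
have [|||X [fKX fLX X1 X2 X3]] := @gather i1 i2 i3 j1 j2 j3 K L ui uj fK fL.
- by split; apply: zero0.
- by split; apply: zero0.
- exact: lt_le_trans K11 L11.
exists (K + X), (L - X :: rem L s); split.
- apply: qconn_trans (qconn_swap _ _ _ fKX fLX) => //.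
  by apply: qconn_perm; rewrite perm_cons perm_to_rem.
- by rewrite mxE -[1]add0r lerD//; apply: (fiber_ge0 fK).
- by rewrite mxE lerDl.
- by rewrite mxE lerDl.
Qed.

Lemma fiber_le_eq A B : fib A -> fib B -> (forall i j, B i j <= A i j) -> A = B.
Proof.
move=> fA fB leBA; apply/matrixP => i j; apply/eqP; rewrite eq_le leBA andbT.
have [rD _] := zero_margins_fiberB fB fA.
rewrite leNgt; apply/negP => AB.
have BA : 0 < (A - B) i j by rewrite !mxE subr_gt0.
have [j'] := sum0_neg (rD i) BA.
by rewrite !mxE subr_lt0 ltNge leBA.
Qed.

(** Three rounds of [gather_list], with the labels rotated, collect the three entries to be gained
    in a single member, since no round lowers what the earlier ones gathered. One swap along the
    hexagon then suffices. *)
Lemma exchange_hexagon i1 i2 i3 j1 j2 j3 A s :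
  uniq [:: i1; i2; i3] -> uniq [:: j1; j2; j3] ->
  (forall B, B \in A :: s -> fib B) ->
  1 <= A i1 j2 -> 1 <= A i2 j3 -> 1 <= A i3 j1 ->
  let S := \sum_(B <- s) B in
  [/\ S i1 j3 = 0, S i2 j1 = 0 & S i3 j2 = 0] ->
  [/\ 1 <= S i1 j1, 1 <= S i2 j2 & 1 <= S i3 j3] ->
  exists s', qconn (A :: s) (A + exchange6 i1 i2 i3 j1 j2 j3 :: s').
Proof.
move=> ui uj fs a12 a23 a31 S S0 [S1 S2 S3].
have fA : fib A by apply: fs; rewrite inE eqxx.
have {}fs B : B \in s -> fib B by move=> Bs; apply: fs; rewrite inE Bs orbT.
case: s @S fs S0 S1 S2 S3 => [|K s] S fs S0 S1 S2 S3.
  by move: S1; rewrite /S big_nil mxE.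
have [ui2 uj2] : uniq [:: i2; i3; i1] /\ uniq [:: j2; j3; j1].
  by rewrite /= !inE !(uniq3P ui) !(uniq3P uj).
have [ui3 uj3] : uniq [:: i3; i1; i2] /\ uniq [:: j3; j1; j2].
  by rewrite /= !inE !(uniq3P ui) !(uniq3P uj).
have [S13 S21 S32] := S0.
have [K1 [s1 [q1 K11 _ _]]] := gather_list ui uj fs S0 S1.
have [fs1 _ e1] := qconn_inv q1 fs.
have [||K2 [s2 [q2 K22 _ K11']]] := gather_list ui2 uj2 fs1; rewrite ?e1//.
have [fs2 _ e2] := qconn_inv q2 fs1; rewrite e1 in e2.
have [||K3 [s3 [q3 K33 K11'' K22']]] := gather_list ui3 uj3 fs2; rewrite ?e2//.
have [fs3 _ _] := qconn_inv q3 fs2.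
have fK3 : fib K3 by apply: fs3; rewrite inE eqxx.
exists (K3 - exchange6 i1 i2 i3 j1 j2 j3 :: s3).
apply: qconn_trans (qconn_cons A (qconn_trans q1 (qconn_trans q2 q3))) _.
apply: qconn_swap => //; first exact: in_fiber_exchange6.
by apply: in_fiberB_exchange6 => //; lia.
Qed.

(* For a hexagon, a nonzero entry of [A] or of the other members at one of the three
   positions of its 3 x 3 minor off the hexagon allows a 4-cycle instead; if all of
   them vanish, the entries to be gained can be gathered by [gather], as a conformal
   cycle through one of them never removes another. *)
Lemma absorb_step A B s : (forall D, D \in A :: s -> fib D) -> fib B ->
  (forall i j, B i j <= (\sum_(D <- A :: s) D) i j) -> A != B ->
  exists A' s', qconn (A :: s) (A' :: s') /\ excess A' B < excess A B.
Proof.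
move=> fs fB leB AB.
have fA : fib A by apply: fs; rewrite inE eqxx.
have pA := fiber_ge0 fA; have pB := fiber_ge0 fB.
have fs' D : D \in s -> fib D by move=> Ds; apply: fs; rewrite inE Ds orbT.
have pS i j : 0 <= (\sum_(D <- s) D) i j by apply: (@entry_sum_ge0 r c).
have Sgt i j : A i j < B i j -> 1 <= (\sum_(D <- s) D) i j.
  by move=> lt; have := leB i j; rewrite big_cons mxE /=; lia.
have Agt i j : B i j < A i j -> 1 <= A i j by have := pB i j; lia.
have [i [j Dij]] : exists i j, A i j < B i j.
  case: (pickP (fun p => A p.1 p.2 < B p.1 p.2)) => [[i j] /= lt|n]; first by exists i, j.
  case/eqP: AB; apply: fiber_le_eq => // i j.
  by have /negbT := n (i, j); rewrite -leNgt.
have BA : 0 < (B - A) i j by rewrite !mxE subr_gt0.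
case: (conformal_cycle (zero_margins_fiberB fA fB) BA) => [[i' [j' []]]|].
  rewrite !mxE subr_gt0 !subr_lt0 => d1 d2 d3.
  have i1' : i != i' by apply/eqP => e; subst; move: (lt_trans d1 d3); rewrite ltxx.
  have j1' : j != j' by apply/eqP => e; subst; move: (lt_trans d1 Dij); rewrite ltxx.
  have [s' e] := exchange_list nd i1' j1' fs (Agt _ _ d1) (Agt _ _ d2) (Sgt _ _ Dij) (Sgt _ _ d3).
  by exists (A + exchange4 i i' j j'), s'; split=> //; apply: excess_exchange4.
move=> [i2 [i3 [j2 [j3 [ui uj [d12 d23 d31] [d22 d33]]]]]].
move: d12 d23 d31 d22 d33; rewrite !mxE !subr_gt0 !subr_lt0 => d12 d23 d31 d22 d33.
have a12 := Agt _ _ d12; have a23 := Agt _ _ d23; have a31 := Agt _ _ d31.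
have S11 := Sgt _ _ Dij; have S22 := Sgt _ _ d22; have S33 := Sgt _ _ d33.
have ri := uniq3P ui; have cj := uniq3P uj.
have four x y u v : x != y -> u != v -> 1 <= A x v -> 1 <= A y u ->
    1 <= (\sum_(D <- s) D) x u -> 1 <= (\sum_(D <- s) D) y v ->
    excess (A + exchange4 x y u v) B < excess A B ->
    exists A' s', qconn (A :: s) (A' :: s') /\ excess A' B < excess A B.
  move=> xy uv p1 p2 p3 p4 lt; have [s' e] := exchange_list nd xy uv fs p1 p2 p3 p4.
  by exists (A + exchange4 x y u v), s'.
Ltac distinct ri cj := by rewrite ?ri ?cj.
(* A position where [A] is positive may serve as the arbitrary lowered corner of
   [excess_exchange4]. *)
case: (lerP 1 (A i j3)) => A13.
  apply: (four i3 i j3 j) => //; [distinct ri cj..|].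
  by apply: excess_exchange4; rewrite ?ri ?cj.
case: (lerP 1 (A i2 j)) => A21.
  apply: (four i i2 j j2) => //; [distinct ri cj..|].
  by apply: excess_exchange4; rewrite ?ri ?cj.
case: (lerP 1 (A i3 j2)) => A32.
  apply: (four i2 i3 j2 j3) => //; [distinct ri cj..|].
  by apply: excess_exchange4; rewrite ?ri ?cj.
(* A position where another member is positive may serve as the arbitrary raised corner of
   [excess_exchange4']. *)
case: (lerP 1 ((\sum_(D <- s) D) i j3)) => S13.
  apply: (four i2 i j2 j3) => //; [distinct ri cj..|].
  by apply: excess_exchange4'; rewrite ?ri ?cj.
case: (lerP 1 ((\sum_(D <- s) D) i2 j)) => S21.
  apply: (four i3 i2 j3 j) => //; [distinct ri cj..|].
  by apply: excess_exchange4'; rewrite ?ri ?cj.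
case: (lerP 1 ((\sum_(D <- s) D) i3 j2)) => S32.
  apply: (four i i3 j j2) => //; [distinct ri cj..|].
  by apply: excess_exchange4'; rewrite ?ri ?cj.
have Seq0 x y : (\sum_(D <- s) D) x y < 1 -> (\sum_(D <- s) D) x y = 0.
  by have := pS x y; lia.
have S0 := And3 (Seq0 _ _ S13) (Seq0 _ _ S21) (Seq0 _ _ S32).
have [s' e] := exchange_hexagon ui uj fs a12 a23 a31 S0 (And3 S11 S22 S33).
by exists (A + exchange6 i i2 i3 j j2 j3), s'; split=> //; apply: excess_exchange6.
Qed.

Lemma absorb A B s : (forall D, D \in A :: s -> fib D) -> fib B ->
  (forall i j, B i j <= (\sum_(D <- A :: s) D) i j) ->
  exists s', qconn (A :: s) (B :: s').
Proof.
move=> + fB; have [n] : exists n : nat, excess A B < n%:Z.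
  by exists `|excess A B|.+1; have := excess_ge0 A B; lia.
elim: n A s => [|n IH] A s ltn fs leB.
  by have := excess_ge0 A B; lia.
have [<-|AB] := eqVneq A B; first by exists s; apply: qconn_perm.
have [A' [s' [e lt]]] := absorb_step fs fB leB AB.
have [fs' _ e'] := qconn_inv e fs.
have [|//||s'' e''] := IH A' s'; [by lia|by rewrite e'|].
by exists s''; apply: qconn_trans e e''.
Qed.

(** The head of [t] is bounded entrywise by the common sum, so [absorb] makes it the head of [s]; it
    then cancels from both sums. *)
Lemma fiber_connected s t : (forall D, D \in s -> fib D) -> (forall D, D \in t -> fib D) ->
  size s = size t -> \sum_(D <- s) D = \sum_(D <- t) D -> qconn s t.
Proof.
elim: t s => [|B t IH] [|A s]//; first by move=> *; apply: qconn_perm.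
move=> fs ft [sz] e.
have fB : fib B by apply: ft; rewrite inE eqxx.
have ft' D : D \in t -> fib D by move=> Dt; apply: ft; rewrite inE Dt orbT.
have [|s' q] := @absorb A B s fs fB.
  by move=> i j; rewrite e (entry_sum_ge _ _ ft)// inE eqxx.
have [fs' sz' e'] := qconn_inv q fs.
apply: qconn_trans q (qconn_cons B (IH _ _ _ _ _)) => //.
- by move=> D Ds; apply: fs'; rewrite inE Ds orbT.
- by case: sz' => ->.
- by move: e'; rewrite e !big_cons => /addrI.
Qed.
End Absorption.

(** * Toric ideals *)

Section Ideals.
Variables (S : comNzRingType) (G : set S).

Lemma ideal_generated_gen g : G g -> ideal_generated G g.
Proof.
move=> Gg; exists [:: (1, g)]; first by move=> x; rewrite inE => /eqP->.
by rewrite big_seq1 mul1r.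
Qed.

Lemma ideal_generated0 : ideal_generated G 0.
Proof. by exists [::]; rewrite ?big_nil. Qed.

Lemma ideal_generatedD p q :
  ideal_generated G p -> ideal_generated G q -> ideal_generated G (p + q).
Proof.
move=> [s sG ->] [t tG ->]; exists (s ++ t); last by rewrite big_cat.
by move=> x; rewrite mem_cat => /orP[/sG|/tG].
Qed.

Lemma ideal_generatedMl p q : ideal_generated G q -> ideal_generated G (p * q).
Proof.
move=> [s sG ->]; exists [seq (p * x.1, x.2) | x <- s].
  by move=> _ /mapP[x /sG Gx ->].
by rewrite big_map mulr_sumr; apply: eq_bigr => x _; rewrite mulrA.
Qed.

Lemma ideal_generatedB p q :
  ideal_generated G p -> ideal_generated G q -> ideal_generated G (p - q).
Proof.
by move=> Ip Iq; rewrite -mulN1r; apply/ideal_generatedD/ideal_generatedMl.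
Qed.
End Ideals.

(** * Monomials as lists of variables *)

Section Monomials.
Variables (k : fieldType) (A : choiceType).

Definition list_monomial (l : seq A) : polyring k A := \prod_(a <- l) << ucm a >>.

Lemma malgUM (u v : {cmonom A}) :
  << mmul u v >> = << u >> * << v >> :> polyring k A.
Proof. by rewrite malgM_def fgmulUU mulr1. Qed.

Lemma list_monomialP (u : {cmonom A}) : exists l, << u >> = list_monomial l.
Proof.
move: {2}(mdeg u) (erefl (mdeg u)) => n; elim: n u => [|n IH] u du.
  by exists [::]; rewrite /list_monomial big_nil (mdeg_eq0I du).
have [a ua] : exists a, a \in finsupp u.
  by apply/fset0Pn/eqP => u0; move: du; rewrite mdegE u0 big_seq_fset0.
have uE : u = mmul (ucm a) (divcm u (ucm a)).
  apply/eqP/cmP => b; rewrite cmM divcmE cmU; case: eqP => [<-|_].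
    by rewrite subnKC// lt0n cmE_neq0.
  by rewrite subn0.
have [|l ul] := IH (divcm u (ucm a)).
  by move: du; rewrite {1}uE mdegM mdegU => -[].
by exists (a :: l); rewrite {1}uE malgUM ul /list_monomial big_cons.
Qed.

(** The term at [u] is traded for one at [v], which is already in the support. *)
Lemma msupp_sub_binomial (p : polyring k A) (u v : {cmonom A}) :
  v \in msupp p -> v != u ->
  (msupp (p - (mcoeff u p)%:MP * (<< u >> - << v >>)) `<=` msupp p `\ u)%fset.
Proof.
move=> vp vu; apply/fsubsetP => w; rewrite in_fsetD1 -!mcoeff_neq0.
have uvE : mcoeff w (<< u >> - << v >> : polyring k A) = (u == w)%:R - (v == w)%:R.
  by rewrite mcoeffB; congr (_ - _); apply: mcoeffU1.
rewrite mcoeffB mcoeffCM uvE.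
have [<-|uw] := eqVneq u w; first by rewrite (negPf vu) subr0 mulr1 subrr eqxx.
have [<-|vw] := eqVneq v w; last by rewrite subr0 mulr0 subr0.
by rewrite mcoeff_neq0 vp.
Qed.

Lemma msizeU1 (u : {cmonom A}) : msize (<< u >> : polyring k A) = (mdeg u).+1.
Proof. by rewrite msizeE msuppU1 big_seq_fset1. Qed.

Lemma msize_list_monomial (l : seq A) : msize (list_monomial l) = (size l).+1.
Proof.
have [u [-> <-]] : exists u, list_monomial l = << u >> /\ mdeg u = size l.
  elim: l => [|a l [u [lE du]]]; first by exists mone; rewrite /list_monomial big_nil mdeg1.
  by exists (mmul (ucm a) u); rewrite mdegM mdegU du malgUM -lE /list_monomial big_cons.
exact: msizeU1.
Qed.
End Monomials.

(** * Independence of Laurent monomials *)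

Section LaurentMonomials.
Variables (k : fieldType) (N : nat).
Implicit Types (x y : 'rV[int]_N).

Lemma ratfunX_neq0 (i : 'I_N) : ratfunX k i != 0.
Proof.
rewrite /ratfunX tofrac_eq0; apply/eqP => /(congr1 (mpoly.mcoeff (mpoly.mnm1 i))).
by rewrite mpoly.mcoeffX eqxx mpoly.mcoeff0 => /eqP; rewrite oner_eq0.
Qed.

Lemma laurent_monomial0 : laurent_monomial k (0 : 'rV[int]_N) = 1.
Proof. by rewrite /laurent_monomial big1// => i _; rewrite mxE expr0z. Qed.

Lemma laurent_monomialD x y :
  laurent_monomial k (x + y) = laurent_monomial k x * laurent_monomial k y.
Proof.
rewrite /laurent_monomial -big_split/=; apply: eq_bigr => i _.
by rewrite mxE expfzDr// ratfunX_neq0.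
Qed.

Lemma laurent_monomial_sum (I : Type) (l : seq I) (F : I -> 'rV[int]_N) :
  laurent_monomial k (\sum_(a <- l) F a) = \prod_(a <- l) laurent_monomial k (F a).
Proof. exact: (big_morph _ laurent_monomialD laurent_monomial0). Qed.

(** Faithful only on nonnegative rows, because [absz] forgets signs. *)
Definition multinom_of_row x : mpoly.multinom N :=
  mpoly.Multinom [tuple absz (x 0 i) | i < N].

Lemma multinom_of_row_inj x y : (forall i, 0 <= x 0 i) -> (forall i, 0 <= y 0 i) ->
  multinom_of_row x = multinom_of_row y -> x = y.
Proof.
move=> x0 y0 xy; apply/rowP => i.
have /mpoly.mnmP/(_ i) := xy; rewrite !mpoly.mnmE => e.
by rewrite -[LHS]gez0_abs// -[RHS]gez0_abs// e.
Qed.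

Lemma laurent_monomial_ge0 x : (forall i, 0 <= x 0 i) ->
  laurent_monomial k x = FracField.tofrac (mpoly.mpolyX k (multinom_of_row x)).
Proof.
move=> x0; rewrite /laurent_monomial mpoly.mpolyXE_id rmorph_prod/=.
apply: eq_bigr => i _; rewrite mpoly.mnmE rmorphXn/= -[x 0 i in LHS]gez0_abs//.
Qed.

(** With nonnegative exponents the relation already holds in the polynomial ring, where the
    coefficient at [x] collects all terms with [e u = x]. *)
Lemma laurent_monomial_free (I : choiceType) (d : seq I) (c : I -> k) (e : I -> 'rV[int]_N) :
  (forall u, u \in d -> forall i, 0 <= e u 0 i) ->
  \sum_(u <- d) ratfunC N (c u) * laurent_monomial k (e u) = 0 ->
  forall x, (forall i, 0 <= x 0 i) -> \sum_(u <- d | e u == x) c u = 0.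
Proof.
move=> e0 s0 x x0.
pose q := \sum_(u <- d) mpoly.mpolyC N (c u) * mpoly.mpolyX k (multinom_of_row (e u)).
have q0 : q = 0.
  apply/eqP; rewrite -tofrac_eq0 -s0 rmorph_sum/=; apply/eqP.
  rewrite big_seq [RHS]big_seq; apply: eq_bigr => u ud.
  by rewrite rmorphM/= laurent_monomial_ge0//; apply: e0.
have := congr1 (mpoly.mcoeff (multinom_of_row x)) q0.
rewrite raddf_sum mpoly.mcoeff0 /= => q1; rewrite -[RHS]q1.
rewrite [LHS]big_mkcond big_seq [RHS]big_seq; apply: eq_bigr => u ud.
rewrite mpoly.mcoeffCM mpoly.mcoeffX; case: eqP => [->|ne]; first by rewrite eqxx mulr1.
case: eqP => [/multinom_of_row_inj e1|_]; last by rewrite mulr0.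
by case: ne; apply: e1 => //; apply: e0.
Qed.
End LaurentMonomials.

(** * Reduction of toric ideals to binomials *)

Section ToricIdeals.
Variables (k : fieldType) (N : nat) (A : set 'rV[int]_N).
Hypothesis A_ge0 : forall (a : A) i, 0 <= (val a : 'rV[int]_N) 0 i.
Variable J : set (polyring k A).
Hypothesis J0 : J 0.
Hypothesis JD : forall p q, J p -> J q -> J (p + q).
Hypothesis JM : forall p q, J q -> J (p * q).

Lemma toric_map_list (l : seq A) :
  toric_map (list_monomial k l) = laurent_monomial k (\sum_(a <- l) val a).
Proof.
rewrite laurent_monomial_sum rmorph_prod/=; apply: eq_bigr => a _.
exact: toric_mapX.
Qed.

Hypothesis J_binomial : forall l1 l2 : seq A,
  \sum_(a <- l1) val a = \sum_(a <- l2) val a ->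
  J (list_monomial k l1 - list_monomial k l2).

(** Induction on the number of terms. The coefficients of the terms with a given image sum to 0, so
    a term [u] shares its image with another term [v], and subtracting a multiple of their binomial
    removes [u] without creating new terms. *)
Lemma toric_ideal_binomials (p : polyring k A) : toric_map p = 0 -> J p.
Proof.
have [L LE] := boolp.choice (@list_monomialP k A).
pose e u : 'rV[int]_N := \sum_(a <- L u) val a.
have e0 u i : 0 <= e u 0 i by rewrite summxE; apply: sumr_ge0.
have mE u : toric_monomial k u = laurent_monomial k (e u).
  by rewrite -toric_map_list -LE /toric_map mmapU /= (ratfunC_monoid_morphism k N).1 mul1r.
move: {2}#|` msupp p|.+1 (ltnSn #|` msupp p|) => n; elim: n p => // n IH p.
rewrite ltnS => sp p0.
have [->//|] := eqVneq p 0; rewrite -msupp_eq0 => /fset0Pn[u up].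
have s0 : \sum_(v <- msupp p | e v == e u) mcoeff v p = 0.
  apply: (@laurent_monomial_free k N _ (msupp p) (fun v => mcoeff v p) e _ _) => //.
  by rewrite -[RHS]p0 /toric_map mmapE; apply: eq_bigr => v _; rewrite mE.
have [v /and3P[vp vu /eqP evu]] : exists v, [&& v \in msupp p, v != u & e v == e u].
  apply/not_existsP => nv; move: s0; rewrite big_mkcond (big_fsetD1 u)//= eqxx.
  rewrite big_seq big1 => [|v].
    by rewrite addr0 => /eqP; rewrite mcoeff_eq0 up.
  rewrite in_fsetD1 => /andP[vu vp]; case: ifP => // ev.
  by case: (nv v); rewrite vp vu ev.
pose b : polyring k A := << u >> - << v >>.
have Jb : J b by rewrite /b !LE; apply: J_binomial; rewrite -!/(e _) evu.
have b0 : toric_map b = 0.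
  by rewrite /b rmorphB/= !LE !toric_map_list -!/(e _) evu subrr.
pose q := p - (mcoeff u p)%:MP * b.
have -> : p = q + (mcoeff u p)%:MP * b by rewrite /q subrK.
apply: JD; last exact: JM.
apply: IH; last by rewrite /q rmorphB rmorphM /= p0 b0 mulr0 subr0.
have sq := msupp_sub_binomial vp vu.
apply: leq_trans sp; rewrite (cardfsD1 u (msupp p)) up add1n ltnS.
exact: fsubset_leq_card sq.
Qed.
End ToricIdeals.

(** * Smoothness *)

Section Riesz.
Variables (R : realType) (N : nat) (P : set 'rV[R]_N) (v : 'rV[R]_N).
Hypothesis Pv : P v.
Local Notation cone := (normal_cone P v).

Lemma pairingDl (x y z : 'rV[R]_N) : pairing (x + y) z = pairing x z + pairing y z.
Proof. by rewrite /pairing -big_split/=; apply: eq_bigr => i _; rewrite mxE mulrDl. Qed.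

Lemma normal_coneD x y : cone x -> cone y -> cone (x + y).
Proof.
move=> [_ cx] [_ cy]; split=> // z Pz.
by rewrite !pairingDl lerD ?cx ?cy.
Qed.

(* A half-orthant has the Riesz decomposition property: take coordinatewise minima. *)
Lemma unimodular_riesz a1 a2 b1 b2 : unimodular cone ->
  cone a1 -> cone a2 -> cone b1 -> cone b2 -> a1 + a2 = b1 + b2 ->
  exists g11 g12 g21 g22, [/\ [/\ cone g11, cone g12, cone g21 & cone g22],
    a1 = g11 + g12, a2 = g21 + g22, b1 = g11 + g21 & b2 = g12 + g22].
Proof.
move=> [d [_ [q _ [f [[fun_f inj_f surj_f] _]]]]] Ca1 Ca2 Cb1 Cb2 e.
have H x : cone x -> forall i : 'I_d, (i < q)%N -> 0 <= f x 0 i by move/fun_f.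
pose g : 'rV[R]_d := \row_i Num.min (f a1 0 i) (f b1 0 i).
have fe : f a1 + f a2 = f b1 + f b2 by rewrite -!linearD e.
have fei i : f a1 0 i + f a2 0 i = f b1 0 i + f b2 0 i.
  by move/rowP/(_ i): fe; rewrite !mxE.
have [g11 C11 E11] : exists2 x, cone x & f x = g.
  by apply: surj_f => i iq; rewrite mxE le_min !H.
have [g12 C12 E12] : exists2 x, cone x & f x = f a1 - g.
  by apply: surj_f => i iq; rewrite !mxE subr_ge0 ge_min lexx.
have [g21 C21 E21] : exists2 x, cone x & f x = f b1 - g.
  by apply: surj_f => i iq; rewrite !mxE subr_ge0 ge_min lexx orbT.
have [g22 C22 E22] : exists2 x, cone x & f x = f b2 - (f a1 - g).
  apply: surj_f => i iq; rewrite !mxE; have := fei i.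
  by have := H _ Ca2 i iq; have := H _ Cb2 i iq; case: (leP (f a1 0 i) (f b1 0 i)); lra.
have inj x y : cone x -> cone y -> f x = f y -> x = y.
  by move=> Cx Cy; apply: inj_f; rewrite in_setE.
exists g11, g12, g21, g22; split => //; apply: inj => //; try exact: normal_coneD.
- by rewrite linearD E11 E12 addrC subrK.
- rewrite linearD E21 E22 addrA addrAC -addrA.
  by rewrite opprB [g - _ + _]addrC; apply/rowP => i; have := fei i; rewrite !mxE; lra.
- by rewrite linearD E11 E21 addrC subrK.
- by rewrite linearD E12 E22 addrC subrK.
Qed.
End Riesz.

Lemma pairing_mxvec (R : realType) m n (W X : 'M[R]_(m, n)) :
  pairing (mxvec W) (mxvec X) = \sum_i \sum_j W i j * X i j.
Proof.
rewrite /pairing pair_big /= (reindex _ (curry_mxvec_bij _ _)) /=.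
by apply: eq_bigr => -[i j] _ /=; rewrite !mxvecE.
Qed.

Lemma pairingDr (R : realType) n (x y z : 'rV[R]_n) :
  pairing x (y + z) = pairing x y + pairing x z.
Proof. by rewrite /pairing -big_split/=; apply: eq_bigr => i _; rewrite mxE mulrDr. Qed.

(** * Degenerate vertices of transportation polytopes *)

Section Degenerate.
Variables (R : realType) (r : 'I_3 -> nat) (c : 'I_4 -> nat).
Variables (i1 i2 i3 : 'I_3) (j1 j2 j3 j4 : 'I_4).
Hypotheses (ui : uniq [:: i1; i2; i3]) (uj : uniq [:: j1; j2; j3; j4]).
Local Notation T := (transportation R r c).

(** Entries are listed in the order of the labels [i1, i2, i3] and [j1, .., j4], whatever indices
    these denote. *)
Definition table (L : seq (seq R)) : 'M[R]_(3, 4) :=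
  \matrix_(i, j) nth 0 (nth [::] L (index i [:: i1; i2; i3])) (index j [:: j1; j2; j3; j4]).

Lemma tableE x11 x12 x13 x14 x21 x22 x23 x24 x31 x32 x33 x34 :
  let X := table [:: [:: x11; x12; x13; x14]; [:: x21; x22; x23; x24]; [:: x31; x32; x33; x34]] in
  ((X i1 j1 = x11) * (X i1 j2 = x12) * (X i1 j3 = x13) * (X i1 j4 = x14)) *
  ((X i2 j1 = x21) * (X i2 j2 = x22) * (X i2 j3 = x23) * (X i2 j4 = x24)) *
  ((X i3 j1 = x31) * (X i3 j2 = x32) * (X i3 j3 = x33) * (X i3 j4 = x34)).
Proof. by move=> X; do !split; rewrite mxE /= ?eqxx ?(uniq3P ui) ?(uniq4P uj). Qed.

Lemma forall_entries (Q : 'I_3 -> 'I_4 -> Prop) :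
  Q i1 j1 -> Q i1 j2 -> Q i1 j3 -> Q i1 j4 ->
  Q i2 j1 -> Q i2 j2 -> Q i2 j3 -> Q i2 j4 ->
  Q i3 j1 -> Q i3 j2 -> Q i3 j3 -> Q i3 j4 -> forall i j, Q i j.
Proof.
move=> + + + + + + + + + + + + i j.
have := uniq_full ui erefl i; have := uniq_full uj erefl j.
by rewrite !inE => /or4P[] /eqP-> /or3P[] /eqP->.
Qed.

Lemma mem_transportation (X : 'M[R]_(3, 4)) :
  (forall i j, 0 <= X i j) ->
  [/\ X i1 j1 + X i1 j2 + X i1 j3 + X i1 j4 = (r i1)%:R,
      X i2 j1 + X i2 j2 + X i2 j3 + X i2 j4 = (r i2)%:R &
      X i3 j1 + X i3 j2 + X i3 j3 + X i3 j4 = (r i3)%:R] ->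
  [/\ X i1 j1 + X i2 j1 + X i3 j1 = (c j1)%:R,
      X i1 j2 + X i2 j2 + X i3 j2 = (c j2)%:R,
      X i1 j3 + X i2 j3 + X i3 j3 = (c j3)%:R &
      X i1 j4 + X i2 j4 + X i3 j4 = (c j4)%:R] ->
  T (mxvec X).
Proof.
move=> X0 [r1 r2 r3] [c1 c2 c3 c4]; exists X => //; split=> // u.
  have := uniq_full uj erefl u; rewrite (sum3 _ ui) !inE.
  by case/or4P => /eqP->.
have := uniq_full ui erefl u; rewrite (sum4 _ uj) !inE.
by case/or3P => /eqP->.
Qed.

Lemma transportationP (x : 'rV[R]_(3 * 4)) : T x -> exists X : 'M[R]_(3, 4),
  [/\ x = mxvec X, forall i j, 0 <= X i j,
    forall j, X i1 j + X i2 j + X i3 j = (c j)%:R &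
    forall i, X i j1 + X i j2 + X i j3 + X i j4 = (r i)%:R].
Proof.
move=> [X [X0 cX rX] <-]; exists X; split=> // u.
  by rewrite -cX (sum3 _ ui).
by rewrite -rX (sum4 _ uj).
Qed.

Lemma pairing_entries (W X : 'M[R]_(3, 4)) : pairing (mxvec W) (mxvec X) =
  (W i1 j1 * X i1 j1 + W i1 j2 * X i1 j2 + W i1 j3 * X i1 j3 + W i1 j4 * X i1 j4) +
  (W i2 j1 * X i2 j1 + W i2 j2 * X i2 j2 + W i2 j3 * X i2 j3 + W i2 j4 * X i2 j4) +
  (W i3 j1 * X i3 j1 + W i3 j2 * X i3 j2 + W i3 j3 * X i3 j3 + W i3 j4 * X i3 j4).
Proof. by rewrite pairing_mxvec (sum3 _ ui) !(sum4 _ uj). Qed.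

(* It suffices that the support of [V] contains no cycle: [W] then marks zeros of
   [V] which determine it. *)
Lemma transportation_vertex (V W : 'M[R]_(3, 4)) : T (mxvec V) ->
  (forall i j, 0 <= W i j) -> (forall i j, W i j * V i j = 0) ->
  (forall X : 'M[R]_(3, 4),
    (forall j, X i1 j + X i2 j + X i3 j = (c j)%:R) ->
    (forall i, X i j1 + X i j2 + X i j3 + X i j4 = (r i)%:R) ->
    (forall i j, W i j = 1 -> X i j = 0) -> X = V) ->
  vertex T (mxvec V).
Proof.
move=> TV W0 WV uniqV; split=> //; exists (mxvec W) => _ /transportationP[X [-> X0 cX rX]] XV.
rewrite !pairing_mxvec.
have -> : \sum_i \sum_j W i j * V i j = 0 by do 2 (apply: big1 => ? _).
have WX0 i j : 0 <= W i j * X i j by rewrite mulr_ge0.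
rewrite lt_neqAle sumr_ge0 => [|i _]; last exact: sumr_ge0.
rewrite andbT eq_sym psumr_eq0 => [|i _]; last exact: sumr_ge0.
apply: contraNN XV => /allP WX; apply/eqP; congr mxvec; apply: uniqV => // i j W1.
have := WX i; rewrite mem_index_enum psumr_eq0// => /(_ isT)/allP/(_ j).
by rewrite mem_index_enum W1 mul1r => /(_ isT)/eqP.
Qed.

(** The set [J] is [{j1}] for [b = false] and [{j1, j4}] for [b = true]; the coefficient [bR] below
    puts both cases into the same formulas. *)
Variable b : bool.
Hypotheses (r1_gt0 : (0 < r i1)%N) (r2_gt0 : (0 < r i2)%N).
Hypotheses (c1_gt0 : (0 < c j1)%N) (c2_gt0 : (0 < c j2)%N) (c3_gt0 : (0 < c j3)%N).
Hypothesis r3E : r i3 = (c j1 + b * c j4)%N.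

Let bR : R := b%:R.

(** [alpha1 + alpha2] sums row [i3] outside [J], and [beta1 + beta2] sums the columns of [J] outside
    row [i3]. *)
Let alpha1 := table [:: [:: 0; 0; 0; 0]; [:: 0; 0; 0; 0]; [:: 0; 1; 0; 0]].
Let alpha2 := table [:: [:: 0; 0; 0; 0]; [:: 0; 0; 0; 0]; [:: 0; 0; 1; 1 - bR]].
Let beta1 := table [:: [:: 1; 0; 0; bR]; [:: 0; 0; 0; 0]; [:: 0; 0; 0; 0]].
Let beta2 := table [:: [:: 0; 0; 0; 0]; [:: 1; 0; 0; bR]; [:: 0; 0; 0; 0]].

Let bR01 : bR = 0 \/ bR = 1.
Proof. by rewrite /bR; case: b; [right|left]. Qed.

Let r3ER : (r i3)%:R = (c j1)%:R + bR * (c j4)%:R :> R.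
Proof. by rewrite r3E natrD natrM. Qed.

Hypothesis total : (r i1 + r i2 + r i3 = c j1 + c j2 + c j3 + c j4)%N.

Let rcR : (r i1)%:R + (r i2)%:R = (c j2)%:R + (c j3)%:R + (1 - bR) * (c j4)%:R :> R.
Proof.
have := congr1 (fun n => n%:R : R) total; rewrite !natrD r3ER.
by move=> e; lra.
Qed.

(* The forms [alpha1 + alpha2] and [beta1 + beta2] agree on [T].  In a Riesz
   decomposition, the common part [g11] of [alpha1] and [beta1] must increase from
   the vertex to a point where only [alpha1] and [beta1] are positive, and must not
   increase to points where only one of them is. Four points [y + z = w + w'] in the
   directions [(alpha1, beta1)], [(alpha2, beta2)], [(alpha1, beta2)] and
   [(alpha2, beta1)] then give a contradiction. *)
Lemma degenerate_not_unimodular (V : 'M[R]_(3, 4)) : T (mxvec V) ->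
  [/\ V i3 j2 = 0, V i3 j3 = 0 & (1 - bR) * V i3 j4 = 0] ->
  [/\ V i1 j1 = 0, bR * V i1 j4 = 0, V i2 j1 = 0 & bR * V i2 j4 = 0] ->
  ~ unimodular (normal_cone T (mxvec V)).
Proof.
move=> TV [v32 v33 v34] [v11 v14 v21 v24] /(unimodular_riesz TV) riesz.
have pa1 X : pairing (mxvec alpha1) (mxvec X) = X i3 j2.
  by rewrite pairing_entries !tableE; lra.
have pa2 X : pairing (mxvec alpha2) (mxvec X) = X i3 j3 + (1 - bR) * X i3 j4.
  by rewrite pairing_entries !tableE; lra.
have pb1 X : pairing (mxvec beta1) (mxvec X) = X i1 j1 + bR * X i1 j4.
  by rewrite pairing_entries !tableE; lra.
have pb2 X : pairing (mxvec beta2) (mxvec X) = X i2 j1 + bR * X i2 j4.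
  by rewrite pairing_entries !tableE; lra.
(* The relation between the four forms holds only on [T], whereas the Riesz property is about
   equality of forms. So [beta1] is replaced by a form that agrees with it on [T]. *)
pose beta1' := mxvec alpha1 + mxvec alpha2 - mxvec beta2.
have pb1' x : T x -> pairing beta1' x = pairing (mxvec beta1) x.
  move=> /transportationP[X [-> X0 cX rX]].
  have : pairing beta1' (mxvec X) + pairing (mxvec beta2) (mxvec X) =
      pairing (mxvec alpha1) (mxvec X) + pairing (mxvec alpha2) (mxvec X).
    by rewrite -!pairingDl subrK.
  rewrite pa1 pa2 pb1 pb2; have := rX i3; have := cX j1; have := cX j4.
  rewrite r3ER; case: bR01 => ->; lra.
have cone_of W : (forall X : 'M[R]_(3, 4), (forall i j, 0 <= X i j) -> 0 <= pairing W (mxvec X)) ->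
    pairing W (mxvec V) = 0 -> normal_cone T (mxvec V) W.
  by move=> W0 WV; split=> // _ /transportationP[X [-> X0 _ _]]; rewrite WV W0.
have bR_ge0 : 0 <= bR by case: bR01 => ->.
have bR_le1 : 0 <= 1 - bR by case: bR01 => ->; rewrite ?subr0 ?subrr.
have Ca1 : normal_cone T (mxvec V) (mxvec alpha1).
  by apply: cone_of => [X X0|]; rewrite pa1.
have Ca2 : normal_cone T (mxvec V) (mxvec alpha2).
  by apply: cone_of => [X X0|]; rewrite pa2 ?v33 ?v34 ?addr0// addr_ge0// mulr_ge0.
have Cb1 : normal_cone T (mxvec V) (mxvec beta1).
  by apply: cone_of => [X X0|]; rewrite pb1 ?v11 ?v14 ?addr0// addr_ge0// mulr_ge0.
have Cb2 : normal_cone T (mxvec V) (mxvec beta2).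
  by apply: cone_of => [X X0|]; rewrite pb2 ?v21 ?v24 ?addr0// addr_ge0// mulr_ge0.
have Cb1' : normal_cone T (mxvec V) beta1'.
  by case: Cb1 => _ Cb1; split=> // x Tx; rewrite !pb1'//; apply: Cb1.
have e : mxvec alpha1 + mxvec alpha2 = beta1' + mxvec beta2 by rewrite subrK.
have [g11 [g12 [g21 [g22 [[G11 G12 G21 G22] E1 E2 F1 F2]]]]] :=
  riesz _ _ _ _ Ca1 Ca2 Cb1' Cb2 e.
have a1V : pairing g11 (mxvec V) + pairing g12 (mxvec V) = 0.
  by rewrite -pairingDl -E1 pa1.
have b1V : pairing g11 (mxvec V) + pairing g21 (mxvec V) = 0.
  by rewrite -pairingDl -F1 pb1'// pb1 v11 v14 addr0.
have b2V : pairing g12 (mxvec V) + pairing g22 (mxvec V) = 0.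
  by rewrite -pairingDl -F2 pb2 v21 v24 addr0.
have h1 X : pairing g11 (mxvec X) + pairing g12 (mxvec X) = X i3 j2.
  by rewrite -pairingDl -E1 pa1.
have h2 X : T (mxvec X) -> pairing g11 (mxvec X) + pairing g21 (mxvec X) = X i1 j1 + bR * X i1 j4.
  by move=> TX; rewrite -pairingDl -F1 pb1'// pb1.
have h3 X : pairing g12 (mxvec X) + pairing g22 (mxvec X) = X i2 j1 + bR * X i2 j4.
  by rewrite -pairingDl -F2 pb2.
have min0 g x : normal_cone T (mxvec V) g -> T x -> pairing g (mxvec V) <= pairing g x.
  by case=> _ /(_ x).
pose S : R := (r i1)%:R + (r i2)%:R.
pose eps := S^-1.
have S_gt0 : 0 < S by rewrite addr_gt0 ?ltr0n.
have epsS : S * eps = 1 by rewrite mulfV// gt_eqF.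
have eps_gt0 : 0 < eps by rewrite invr_gt0.
have eps1 : eps <= 1.
  have : 1 <= S by rewrite -(mulr1n 1) /S -natrD ler_nat addn_gt0 r1_gt0.
  by rewrite /eps => S1; rewrite invf_le1.
have nat1 (n : nat) : (0 < n)%N -> 1 <= n%:R :> R by rewrite ler1n.
(* The rank-one point of the transportation problem on rows [i1], [i2] and the columns outside [J].
   Its entries with positive integral margins are at least [eps]. *)
pose q i j : R := (r i)%:R * (c j)%:R * eps.
have q_ge0 i j : 0 <= q i j by rewrite !mulr_ge0// ltW.
have q_ge i j : (0 < r i)%N -> (0 < c j)%N -> eps <= q i j.
  move=> ri cj; rewrite /q -[leLHS]mul1r ler_pM2r// -natrM ler1n muln_gt0.
  by rewrite ri.
have q_col j : q i1 j + q i2 j = (c j)%:R.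
  by rewrite /q -!mulrDl mulrAC -/S epsS mul1r.
have q_row i : q i j2 + q i j3 + (1 - bR) * q i j4 = (r i)%:R.
  have -> : q i j2 + q i j3 + (1 - bR) * q i j4 =
      (r i)%:R * (((c j2)%:R + (c j3)%:R + (1 - bR) * (c j4)%:R) * eps).
    by rewrite /q; ring.
  by rewrite -rcR -/S epsS mulr1.
(* A point of the face where all of [alpha1, .., beta2] vanish, perturbed. *)
pose base (x11 x12 x13 x21 x22 x23 x31 x32 x33 : R) := table
  [:: [:: x11 * eps; q i1 j2 + x12 * eps; q i1 j3 + x13 * eps; (1 - bR) * q i1 j4];
      [:: x21 * eps; q i2 j2 + x22 * eps; q i2 j3 + x23 * eps; (1 - bR) * q i2 j4];
      [:: (c j1)%:R + x31 * eps; x32 * eps; x33 * eps; bR * (c j4)%:R]].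
have q12 := q_ge _ _ r1_gt0 c2_gt0; have q13 := q_ge _ _ r1_gt0 c3_gt0.
have q22 := q_ge _ _ r2_gt0 c2_gt0; have q23 := q_ge _ _ r2_gt0 c3_gt0.
have c1e : eps <= (c j1)%:R by apply: le_trans eps1 (nat1 _ c1_gt0).
(* The perturbation has zero margins. It may reach -1 where the unperturbed entry is at least [eps],
   and must be nonnegative where that entry is 0. *)
have Tbase x11 x12 x13 x21 x22 x23 x31 x32 x33 :
    [/\ 0 <= x11, -1 <= x12 & -1 <= x13] -> [/\ 0 <= x21, -1 <= x22 & -1 <= x23] ->
    [/\ -1 <= x31, 0 <= x32 & 0 <= x33] ->
    [/\ x11 + x12 + x13 = 0, x21 + x22 + x23 = 0 & x31 + x32 + x33 = 0] ->
    [/\ x11 + x21 + x31 = 0, x12 + x22 + x32 = 0 & x13 + x23 + x33 = 0] ->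
    T (mxvec (base x11 x12 x13 x21 x22 x23 x31 x32 x33)).
  move=> [p11 p12 p13] [p21 p22 p23] [p31 p32 p33] [s1 s2 s3] [t1 t2 t3].
  have m x : -1 <= x -> - eps <= x * eps by move=> x1; rewrite -mulN1r ler_pM2r.
  have m12 := m _ p12; have m13 := m _ p13; have m22 := m _ p22.
  have m23 := m _ p23; have m31 := m _ p31.
  have {}s1 : x11 * eps + x12 * eps + x13 * eps = 0 by rewrite -!mulrDl s1 mul0r.
  have {}s2 : x21 * eps + x22 * eps + x23 * eps = 0 by rewrite -!mulrDl s2 mul0r.
  have {}s3 : x31 * eps + x32 * eps + x33 * eps = 0 by rewrite -!mulrDl s3 mul0r.
  have {}t1 : x11 * eps + x21 * eps + x31 * eps = 0 by rewrite -!mulrDl t1 mul0r.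
  have {}t2 : x12 * eps + x22 * eps + x32 * eps = 0 by rewrite -!mulrDl t2 mul0r.
  have {}t3 : x13 * eps + x23 * eps + x33 * eps = 0 by rewrite -!mulrDl t3 mul0r.
  have c4 : (1 - bR) * q i1 j4 + (1 - bR) * q i2 j4 + bR * (c j4)%:R = (c j4)%:R.
    by rewrite -mulrDr q_col; ring.
  apply: mem_transportation.
  - have eps_ge0 := ltW eps_gt0.
    have shift a x : eps <= a -> - eps <= x -> 0 <= a + x.
      by move=> ea ex; rewrite -(subrr eps) lerD.
    by apply: forall_entries; rewrite tableE; first [exact: mulr_ge0 | exact: shift].
  - rewrite !tableE; split.
    + by rewrite -[RHS](q_row i1) -[RHS]addr0 -s1; ring.
    + by rewrite -[RHS](q_row i2) -[RHS]addr0 -s2; ring.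
    + by rewrite r3ER -[RHS]addr0 -s3; ring.
  - rewrite !tableE; split; last exact: c4.
    + by rewrite -[RHS]addr0 -t1; ring.
    + by rewrite -[RHS](q_col j2) -[RHS]addr0 -t2; ring.
    + by rewrite -[RHS](q_col j3) -[RHS]addr0 -t3; ring.
have Ty := Tbase 1 (-1) 0 0 0 0 (-1) 1 0; have Tz := Tbase 0 0 0 1 0 (-1) (-1) 0 1.
have Tw := Tbase 0 0 0 1 (-1) 0 (-1) 1 0; have Tw' := Tbase 1 (-1) 0 0 1 (-1) (-1) 0 1.
have sumE : base 1 (-1) 0 0 0 0 (-1) 1 0 + base 0 0 0 1 0 (-1) (-1) 0 1 =
    base 0 0 0 1 (-1) 0 (-1) 1 0 + base 1 (-1) 0 0 1 (-1) (-1) 0 1.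
  by apply/matrixP; apply: forall_entries; rewrite [LHS]mxE [RHS]mxE !tableE; ring.
have m11 : -1 <= 1 :> R by rewrite (@le_trans _ _ 0) ?lerN10 ?ler01.
Ltac signs m11 := split; rewrite ?(addr0, add0r, subrr, addNr, lexx, ler01, lerN10, m11).
have {}Ty : T (mxvec (base 1 (-1) 0 0 0 0 (-1) 1 0)) by apply: Ty; signs m11.
have {}Tz : T (mxvec (base 0 0 0 1 0 (-1) (-1) 0 1)) by apply: Tz; signs m11.
have {}Tw : T (mxvec (base 0 0 0 1 (-1) 0 (-1) 1 0)) by apply: Tw; signs m11.
have {}Tw' : T (mxvec (base 1 (-1) 0 0 1 (-1) (-1) 0 1)) by apply: Tw'; signs m11.
have bb : bR * (1 - bR) = 0 by case: bR01 => ->; ring.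
have gsum := congr1 (fun x => pairing g11 (mxvec x)) sumE.
rewrite /= !linearD !pairingDr in gsum.
have y1 := h1 (base 1 (-1) 0 0 0 0 (-1) 1 0).
have y3 := h3 (base 1 (-1) 0 0 0 0 (-1) 1 0).
have w2 := h2 _ Tw; have w1 := h1 (base 1 (-1) 0 0 1 (-1) (-1) 0 1).
rewrite !tableE !mulrA ?bb !(mul0r, mul1r, addr0) in y1 y3 w2 w1.
(* If a sum of two forms vanishes at a point and at the vertex, and one of them is minimal at the
   vertex, then the other does not increase. This applies to [beta2] at [y], to [beta1] at [w] and
   to [alpha1] at [w']. *)
have neg x y xv yv : x + y = 0 -> xv + yv = 0 -> yv <= y -> x <= xv :> R.
  by move=> /eqP + /eqP; rewrite !addr_eq0 => /eqP-> /eqP->; rewrite lerN2.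
have y12 := neg _ _ _ _ y3 b2V (min0 _ _ G22 Ty).
have w11 := neg _ _ _ _ w2 b1V (min0 _ _ G21 Tw).
have w11' := neg _ _ _ _ w1 a1V (min0 _ _ G12 Tw').
have z11 := min0 _ _ G11 Tz.
have y11 : pairing g11 (mxvec V) < pairing g11 (mxvec (base 1 (-1) 0 0 0 0 (-1) 1 0)).
  rewrite -[ltRHS](addrK (pairing g12 (mxvec (base 1 (-1) 0 0 0 0 (-1) 1 0)))) y1.
  move/eqP: a1V; rewrite addr_eq0 => /eqP ->.
  by rewrite ltr_pwDl// lerN2.
have : pairing g11 (mxvec V) + pairing g11 (mxvec V) <
    pairing g11 (mxvec V) + pairing g11 (mxvec V).
  by apply: lt_le_trans (ltr_leD y11 z11) _; rewrite gsum lerD.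
by rewrite ltxx.
Qed.

(** Row [i3] absorbs the columns of [J] entirely. A vertex of the remaining transportation problem,
    with rows [i1], [i2] and columns [j2], [j3], [j4], completes it; there [j4] has margin
    [(1 - bR) * c j4]. *)
Lemma degenerate_vertex : exists V : 'M[R]_(3, 4), [/\ vertex T (mxvec V),
  [/\ V i3 j2 = 0, V i3 j3 = 0 & (1 - bR) * V i3 j4 = 0] &
  [/\ V i1 j1 = 0, bR * V i1 j4 = 0, V i2 j1 = 0 & bR * V i2 j4 = 0]].
Proof.
have bb : bR * (1 - bR) = 0 by case: bR01 => ->; ring.
have e_ge0 : 0 <= (1 - bR) * (c j4)%:R by case: bR01 => ->; rewrite ?(subr0, subrr, mul1r, mul0r).
have b_ge0 : 0 <= bR * (c j4)%:R by case: bR01 => ->; rewrite ?(mul1r, mul0r).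
have nn (n : nat) : 0 <= n%:R :> R by [].
have r1p := nn (r i1); have r2p := nn (r i2); have c1p := nn (c j1).
have c2p := nn (c j2); have c3p := nn (c j3).
pose V x12 x13 x14 x22 x23 x24 := table [:: [:: 0; x12; x13; x14]; [:: 0; x22; x23; x24];
  [:: (c j1)%:R; 0; 0; bR * (c j4)%:R]].
pose W w12 w13 w14 w22 w23 := table [:: [:: 1; w12; w13; w14]; [:: 1; w22; w23; 0];
  [:: 0; 1; 1; 0]].
(* Reduction to the 2 x 3 block: the [x] are its entries, and the [w] mark zeros that determine
   it. *)
have VP x12 x13 x14 x22 x23 x24 w12 w13 w14 w22 w23 :
    [/\ 0 <= x12, 0 <= x13 & 0 <= x14] -> [/\ 0 <= x22, 0 <= x23 & 0 <= x24] ->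
    [/\ 0 <= w12, 0 <= w13 & 0 <= w14] -> 0 <= w22 -> 0 <= w23 ->
    [/\ w12 * x12 = 0, w13 * x13 = 0 & w14 * x14 = 0] -> w22 * x22 = 0 -> w23 * x23 = 0 ->
    x12 + x13 + x14 = (r i1)%:R -> x22 + x23 + x24 = (r i2)%:R ->
    [/\ x12 + x22 = (c j2)%:R, x13 + x23 = (c j3)%:R & x14 + x24 = (1 - bR) * (c j4)%:R] ->
    (forall y12 y13 y14 y22 y23 y24 : R,
      y12 + y13 + y14 = (r i1)%:R -> y22 + y23 + y24 = (r i2)%:R ->
      [/\ y12 + y22 = (c j2)%:R, y13 + y23 = (c j3)%:R & y14 + y24 = (1 - bR) * (c j4)%:R] ->
      [/\ w12 = 1 -> y12 = 0, w13 = 1 -> y13 = 0 & w14 = 1 -> y14 = 0] ->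
      (w22 = 1 -> y22 = 0) -> (w23 = 1 -> y23 = 0) ->
      [/\ y12 = x12, y13 = x13 & y14 = x14] /\ [/\ y22 = x22, y23 = x23 & y24 = x24]) ->
    exists V : 'M[R]_(3, 4), [/\ vertex T (mxvec V),
      [/\ V i3 j2 = 0, V i3 j3 = 0 & (1 - bR) * V i3 j4 = 0] &
      [/\ V i1 j1 = 0, bR * V i1 j4 = 0, V i2 j1 = 0 & bR * V i2 j4 = 0]].
  move=> [x12p x13p x14p] [x22p x23p x24p] [w12p w13p w14p] w22p w23p.
  move=> [wx12 wx13 wx14] wx22 wx23 xr1 xr2 [xc2 xc3 xc4] uniqV.
  exists (V x12 x13 x14 x22 x23 x24); rewrite !tableE; split; last 2 first.
  - by split=> //; rewrite mulrA [_ * bR]mulrC bb mul0r.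
  - have : bR * x14 + bR * x24 = 0 by rewrite -mulrDr xc4 mulrA bb mul0r.
    have bR_ge0 : 0 <= bR by case: bR01 => ->.
    by move/eqP; rewrite paddr_eq0 ?mulr_ge0// => /andP[/eqP-> /eqP->].
  apply: (transportation_vertex (W := W w12 w13 w14 w22 w23)).
  - apply: mem_transportation; first by apply: forall_entries; rewrite tableE.
      rewrite !tableE; split; last by rewrite r3ER !addr0.
        by rewrite add0r.
      by rewrite add0r.
    rewrite !tableE; split; rewrite ?add0r ?addr0//.
    by rewrite xc4; ring.
  - by apply: forall_entries; rewrite tableE.
  - by apply: forall_entries; rewrite !tableE ?mulr0 ?mul0r.
  move=> Y cY rY WY.
  have [W11 W21] : W w12 w13 w14 w22 w23 i1 j1 = 1 /\ W w12 w13 w14 w22 w23 i2 j1 = 1.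
    by rewrite !tableE.
  have [W32 W33] : W w12 w13 w14 w22 w23 i3 j2 = 1 /\ W w12 w13 w14 w22 w23 i3 j3 = 1.
    by rewrite !tableE.
  have Y11 := WY _ _ W11; have Y21 := WY _ _ W21.
  have Y32 := WY _ _ W32; have Y33 := WY _ _ W33.
  have Y31 : Y i3 j1 = (c j1)%:R by rewrite -(cY j1) Y11 Y21 !add0r.
  have Y34 : Y i3 j4 = bR * (c j4)%:R.
    by apply: (@addrI _ (c j1)%:R); rewrite -r3ER -(rY i3) Y31 Y32 Y33 !addr0.
  have WE i j w : W w12 w13 w14 w22 w23 i j = w -> w = 1 -> Y i j = 0.
    by move=> <-; apply: WY.
  have [] := uniqV (Y i1 j2) (Y i1 j3) (Y i1 j4) (Y i2 j2) (Y i2 j3) (Y i2 j4).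
  - by rewrite -(rY i1) Y11 add0r.
  - by rewrite -(rY i2) Y21 add0r.
  - split; rewrite -?(cY j2) -?(cY j3) ?Y32 ?Y33 ?addr0//.
    by apply: (@addIr _ (bR * (c j4)%:R)); rewrite -{1}Y34 cY; ring.
  - by split; apply: WE; rewrite tableE.
  - by apply: WE; rewrite tableE.
  - by apply: WE; rewrite tableE.
  move=> [y12 y13 y14] [y22 y23 y24].
  by apply/matrixP; apply: forall_entries; rewrite tableE.
(* Northwest corner rule for the rows [i1], [i2] and the columns outside [J]. *)
clearbody V W => {V W}; have rc := rcR; move: rc e_ge0 VP.
move: ((1 - bR) * _) => e rc e_ge0 VP.
have [le1|lt1] := leqP (r i1) (c j2).
  have {}le1 : (r i1)%:R <= (c j2)%:R :> R by rewrite ler_nat.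
  apply: (VP (r i1)%:R 0 0 ((c j2)%:R - (r i1)%:R) (c j3)%:R e 0 1 1 0 0);
    rewrite ?subr_ge0 ?mul0r ?mulr0//; try by split; rewrite ?mul0r ?mulr0//; ring.
  + by rewrite !addr0.
  + lra.
  + move=> y12 y13 y14 y22 y23 y24 e1 e2 [f1 f2 f3] [_ /(_ erefl) y13E /(_ erefl) y14E] _ _.
    by split; split; lra.
have {}lt1 : (c j2)%:R <= (r i1)%:R :> R by rewrite ler_nat ltnW.
have [le2|lt2] := leqP (r i1) (c j2 + c j3).
  have {}le2 : (r i1)%:R <= (c j2)%:R + (c j3)%:R :> R by rewrite -natrD ler_nat.
  apply: (VP (c j2)%:R ((r i1)%:R - (c j2)%:R) 0 0 ((c j2)%:R + (c j3)%:R - (r i1)%:R) e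
    0 0 1 1 0); rewrite ?mul0r ?mulr0//; try by split; rewrite ?subr_ge0 ?mul0r ?mulr0//; ring.
  + lra.
  + lra.
  + move=> y12 y13 y14 y22 y23 y24 e1 e2 [f1 f2 f3] [_ _ /(_ erefl) y14E] /(_ erefl) y22E _.
    by split; split; lra.
have {}lt2 : (c j2)%:R + (c j3)%:R <= (r i1)%:R :> R by rewrite -natrD ler_nat ltnW.
apply: (VP (c j2)%:R (c j3)%:R ((r i1)%:R - (c j2)%:R - (c j3)%:R) 0 0 (r i2)%:R
  0 0 0 1 1); rewrite ?mul0r ?mulr0//; try by split; rewrite ?mul0r ?mulr0//; ring.
+ by split=> //; lra.
+ lra.
+ lra.
+ by split; lra.
+ move=> y12 y13 y14 y22 y23 y24 e1 e2 [f1 f2 f3] _ /(_ erefl) y22E /(_ erefl) y23E.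
  by split; split; lra.
Qed.
End Degenerate.

(** Equality of the totals rules out the empty polytope, which is vacuously smooth. *)
Lemma smooth_generic_margins (R : realType) (r : 'I_3 -> nat) (c : 'I_4 -> nat) :
  (\sum_i r i = \sum_j c j)%N -> smooth (transportation R r c) -> generic_margins r c.
Proof.
move=> rc sm i1 i2 i3 j1 j2 j3 j4 ui uj r1 r2 r3 c1 c2 c3.
have tot : (r i1 + r i2 + r i3 = c j1 + c j2 + c j3 + c j4)%N.
  exact: (etrans (esym (sum3 r ui)) (etrans rc (sum4 c uj))).
have no (b : bool) : r i3 <> (c j1 + b * c j4)%N.
  move=> r3E; have [V [vV V3 V12]] := degenerate_vertex R ui uj r3E tot.
  exact: (degenerate_not_unimodular ui uj r1 r2 c1 c2 c3 r3E tot vV.1 V3 V12 (sm _ vV)).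
by split; [have := no false|have := no true]; rewrite ?mul0n ?mul1n ?addn0.
Qed.

Lemma Posz_sum (I : Type) (l : seq I) (F : I -> nat) :
  (\sum_(i <- l) F i)%N%:Z = \sum_(i <- l) (F i)%:Z.
Proof. exact: (big_morph Posz PoszD). Qed.

Lemma ideal_factor (S : comNzRingType) (x y x' y' z : S) :
  x * (y * z) - x' * (y' * z) = z * (x * y - x' * y').
Proof. by ring. Qed.

(** * The toric ideal of a transportation polytope *)

Section TransportationIdeal.
Variables (R : realType) (k : fieldType) (r : 'I_3 -> nat) (c : 'I_4 -> nat).
Local Notation T := (transportation R r c).
Local Notation A := (lattice_points T).
Implicit Types (a : A) (M : 'M[int]_(3, 4)).

Lemma lattice_transportationP M : A (mxvec M) <-> in_fiber r c M.
Proof.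
rewrite /lattice_points /= map_mxvec; split.
  move=> [X [X0 cX rX]] /(can_inj mxvecK) XM.
  have XE i j : X i j = (M i j)%:~R by rewrite XM mxE.
  split=> [i j|i|j]; first by rewrite -(ler0z R) -XE.
    apply: (@intr_inj R); rewrite rmorph_sum/= -pmulrn -(rX i).
    by apply: eq_bigr => j _; rewrite XE.
  apply: (@intr_inj R); rewrite rmorph_sum/= -pmulrn -(cX j).
  by apply: eq_bigr => i _; rewrite XE.
move=> [M0 rM cM]; exists (map_mx intr M) => //; split=> [i j|j|i].
- by rewrite mxE ler0z.
- by under eq_bigr do rewrite mxE; rewrite -rmorph_sum/= cM -pmulrn.
- by under eq_bigr do rewrite mxE; rewrite -rmorph_sum/= rM -pmulrn.
Qed.

Lemma in_fiber_lattice_point a : in_fiber r c (vec_mx (val a)).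
Proof. by apply/lattice_transportationP; rewrite vec_mxK; apply: set_mem (valP a). Qed.

Lemma lattice_point_ge0 a i : 0 <= (val a : 'rV[int]_(3 * 4)) 0 i.
Proof.
by case/mxvec_indexP: i => i j; rewrite -[val a]vec_mxK mxvecE; apply: fiber_ge0 (in_fiber_lattice_point a) _ _.
Qed.

Lemma in_fiber_eq_lattice_point M : in_fiber r c M -> exists a, val a = mxvec M.
Proof.
by move/lattice_transportationP/mem_set => AM; exists (Sub (mxvec M) AM); rewrite SubK.
Qed.

(** As [msize] is the degree plus one, the bound 3 means degree at most two. *)
Definition quadrics : set (polyring k A) :=
  [set g | toric_ideal k T g /\ (msize g <= 3)%N].

Local Notation J := (ideal_generated quadrics).
Local Notation mon := (list_monomial k).

Lemma toric_map_ideal p : J p -> toric_map p = 0.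
Proof.
move=> [s sG ->]; rewrite rmorph_sum/= big_seq big1// => x /sG[x0 _].
by rewrite rmorphM /= x0 mulr0.
Qed.

Lemma binomial_quadric (l1 l2 : seq A) : (size l1 <= 2)%N -> (size l2 <= 2)%N ->
  \sum_(a <- l1) val a = \sum_(a <- l2) val a -> J (mon l1 - mon l2).
Proof.
move=> s1 s2 e; apply: ideal_generated_gen; split.
  by rewrite /toric_ideal /= rmorphB/= !toric_map_list e subrr.
apply: leq_trans (msizeD_le _ _) _; rewrite msizeN geq_max.
by rewrite !msize_list_monomial !ltnS s1 s2.
Qed.

Lemma list_monomial_cat (l1 l2 : seq A) : mon (l1 ++ l2) = mon l1 * mon l2.
Proof. exact: big_cat. Qed.

Lemma binomial_trans p q s : J (p - q) -> J (q - s) -> J (p - s).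
Proof. by move=> pq qs; rewrite -(subrK q p) -addrA; apply: ideal_generatedD. Qed.

Lemma list_monomial0 : mon ([::] : seq A) = 1.
Proof. by rewrite /list_monomial big_nil. Qed.

Lemma list_monomial2 (a1 a2 : A) : mon [:: a1; a2] = << ucm a1 >> * << ucm a2 >>.
Proof. by rewrite /list_monomial big_cons big_seq1. Qed.

(* The junk value 0 is taken outside the fiber. *)
Definition point_variable M : polyring k A :=
  if insub (mxvec M) is Some a then << ucm (a : A) >> else 0.

Lemma point_variableE a M : val a = mxvec M -> point_variable M = << ucm a >>.
Proof. by rewrite /point_variable => <-; rewrite valK. Qed.

Lemma quadratically_connected_binomial s t : quadratically_connected r c s t ->
  J (\prod_(M <- s) point_variable M - \prod_(M <- t) point_variable M).
Proof.
elim=> {s t} [s t st|M1 M2 M3 M4 s f1 f2 f3 f4 e|s t u _ st _ tu].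
- by rewrite (perm_big _ st) subrr; apply: ideal_generated0.
- have [a1 e1] := in_fiber_eq_lattice_point f1; have [a2 e2] := in_fiber_eq_lattice_point f2.
  have [a3 e3] := in_fiber_eq_lattice_point f3; have [a4 e4] := in_fiber_eq_lattice_point f4.
  have q : J (<< ucm a1 >> * << ucm a2 >> - << ucm a3 >> * << ucm a4 >>).
    have := @binomial_quadric [:: a1; a2] [:: a3; a4] isT isT.
    rewrite !list_monomial2; apply; rewrite !big_cons !big_nil !addr0 e1 e2 e3 e4.
    by rewrite -!linearD e.
  rewrite !big_cons (point_variableE e1) (point_variableE e2).
  rewrite (point_variableE e3) (point_variableE e4).
  rewrite ideal_factor; exact: ideal_generatedMl.
- exact: binomial_trans st tu.
Qed.

(** Recovers the length of a list from its sum when the margins are not all zero. *)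
Lemma sum_entries_fiber (s : seq 'M[int]_(3, 4)) : (forall M, M \in s -> in_fiber r c M) ->
  \sum_i \sum_j (\sum_(M <- s) M) i j = (size s * \sum_i r i)%:Z.
Proof.
elim: s => [|M s IH] fs.
  by rewrite big_nil mul0n big1// => i _; rewrite big1// => j _; rewrite mxE.
have [_ rM _] : in_fiber r c M by apply: fs; rewrite inE eqxx.
have rS i : \sum_j (\sum_(M <- M :: s) M) i j =
    (r i)%:Z + \sum_j (\sum_(M <- s) M) i j.
  by rewrite -rM -big_split/=; apply: eq_bigr => j _; rewrite big_cons mxE.
rewrite (eq_bigr _ (fun i _ => rS i)) big_split/= IH => [|M' Ms].
  by rewrite mulSn PoszD Posz_sum.
by apply: fs; rewrite inE Ms orbT.
Qed.

(* If all margins vanish then the only lattice point is 0, and lists with the same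
   sum may have different lengths. *)
Lemma list_binomial (l1 l2 : seq A) : smooth T ->
  \sum_(a <- l1) val a = \sum_(a <- l2) val a -> J (mon l1 - mon l2).
Proof.
move=> sm e; have [r0|r0] := eqVneq (\sum_i r i)%N 0%N.
  have a0 a : val a = 0.
    have [M0 rM _] := in_fiber_lattice_point a.
    rewrite -[LHS]vec_mxK -[RHS](linear0 mxvec); congr mxvec.
    apply/matrixP => i j; rewrite [RHS]mxE; apply/eqP.
    have : \sum_j vec_mx (val a) i j == 0.
      by rewrite rM; move/eqP: r0; rewrite sum_nat_eq0 => /forallP/(_ i)/=.
    by rewrite psumr_eq0// => /allP/(_ j); rewrite mem_index_enum => /(_ isT).
  (* The linear binomials [<< ucm a >> - 1] lie in the ideal, so every monomial is congruent to
     1. *)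
  have J1 l : J (mon l - 1).
    elim: l => [|a l IH]; first by rewrite list_monomial0 subrr; apply: ideal_generated0.
    apply: (@binomial_trans _ (mon [:: a])); last first.
      rewrite -list_monomial0.
      by apply: binomial_quadric => //; rewrite big_cons !big_nil a0 addr0.
    rewrite -cat1s list_monomial_cat -{2}[mon [:: a]]mulr1 -mulrBr.
    exact: ideal_generatedMl.
  have -> : mon l1 - mon l2 = (mon l1 - 1) - (mon l2 - 1) by rewrite opprB addrA subrK.
  exact: ideal_generatedB.
pose mx (l : seq A) := [seq vec_mx (val a) | a <- l] : seq 'M[int]_(3, 4).
have fib l M : M \in mx l -> in_fiber r c M.
  by move=> /mapP[a _ ->]; apply: in_fiber_lattice_point.
have monE l : mon l = \prod_(M <- mx l) point_variable M.
  by rewrite big_map; apply: eq_bigr => a _; rewrite (point_variableE (esym (vec_mxK (val a)))).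
have sumE : \sum_(M <- mx l1) M = \sum_(M <- mx l2) M.
  by rewrite !big_map -!linear_sum e.
have sizeE : size (mx l1) = size (mx l2).
  have := sum_entries_fiber (@fib l1); rewrite sumE (sum_entries_fiber (@fib l2)).
  by move=> [/eqP]; rewrite eqn_pmul2r ?lt0n// => /eqP.
case: l1 e sumE sizeE => [|a l1] e sumE sizeE.
  by case: l2 e sumE sizeE => // *; rewrite subrr; apply: ideal_generated0.
rewrite !monE; apply: quadratically_connected_binomial.
apply: fiber_connected sumE => //; [|exact: fib|exact: fib].
(* The lattice point [a] witnesses that the row and column totals agree. *)
apply: smooth_generic_margins sm.
have [_ rM cM] := in_fiber_lattice_point a.
have : (\sum_i r i)%N%:Z = (\sum_j c j)%N%:Z; last by case.
rewrite !Posz_sum -(eq_bigr _ (fun i _ => rM i)) -(eq_bigr _ (fun j _ => cM j)).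
exact: exchange_big.
Qed.
End TransportationIdeal.

Theorem mainTheorem9 (R : realType) (k : fieldType)
    (r : 'I_3 -> nat) (c : 'I_4 -> nat) :
  smooth (transportation R r c) ->
  generated_in_degree 2 (toric_ideal k (transportation R r c)).
Proof.
move=> sm; exists (@quadrics R k r c) => [g [_]//|].
apply/seteqP; split=> p; last by move/toric_map_ideal.
apply: toric_ideal_binomials.
- exact: lattice_point_ge0.
- exact: ideal_generated0.
- exact: ideal_generatedD.
- exact: ideal_generatedMl.
- by move=> l1 l2; apply: list_binomial.
Qed.
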